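(* Suppose that (A1) $\lim_{n\to\infty}\int_{\mathbb{Y}}|f_{\theta_n}(y)-f_\theta(y)|\,\mu(dy)=0$ whenever $\theta_n,\theta\in\Theta$, $\theta_n\to\theta$, and $\mu_\theta,\mu_{\theta'}$ are mutually absolutely continuous for all $\theta,\theta'\in\Theta$; (A2) $g$ is continuously differentiable on $(0,1)$ and continuous at $0$ and $1$; (A3) $g'(t)>0$ for $0<t<1$; and that $\Theta_0$ is closed. Then there exists an optimal rule $\delta^*\in\Delta$ for the problem $$\max_{\delta\in\Delta}\int_{\Theta_1}g(p(\theta;\delta))\,\Lambda_1(d\theta)\quad\text{subject to } \sup_{\theta\in\Theta_0}p(\theta;\delta)\le\alpha$$ such that $\sup_{\theta\in\Theta_0}p(\theta;\delta^* )=\alpha$ and such that, for some constant $\kappa\ge0$, a measurable function $\gamma:\mathbb{Y}\to[0,1]$ and a probability measure $\widetilde\Lambda_0$ on $\Theta_0$, for each $y\in\mathbb{Y}$, $$\delta^*(y)=\begin{cases}1,&H(y)>\kappa\widetilde f_{\widetilde\Lambda_0}(y)\\ \gamma(y),&H(y)=\kappa\widetilde f_{\widetilde\Lambda_0}(y)\\ 0,&H(y)<\kappa\widetilde f_{\widetilde\Lambda_0}(y),\end{cases}$$ where $H(y):=\int_{\Theta_1}g'(p(\theta;\delta^* ))f_\theta(y)\,\Lambda_1(d\theta)$ and $\widetilde f_{\widetilde\Lambda_0}(y):=\int_{\Theta_0}f_\theta(y)\,\widetilde\Lambda_0(d\theta)$.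
   Context: Let $\Theta\subset\mathbb{R}^{d_1}$ ($d_1\ge1$) be compact and partitioned into two disjoint non-empty subsets $\Theta_0$ and $\Theta_1=\Theta\setminus\Theta_0$. Let $\mathbb{Y}\subset\mathbb{R}^{d_2}$ ($d_2\ge1$) be the observation space, $\mu$ a $\sigma$-finite measure on $\mathbb{Y}$, and for each $\theta\in\Theta$ let $f_\theta$ be a probability density function with respect to $\mu$; $(\theta,y)\mapsto f_\theta(y)$ is jointly measurable. Let $\mu_\theta$ be the probability measure with $d\mu_\theta/d\mu=f_\theta$. $\Delta$ is the set of all randomized decision rules, i.e. measurable functions $\delta:\mathbb{Y}\to[0,1]$, and $p(\theta;\delta)=\int_{\mathbb{Y}}\delta(y)f_\theta(y)\,\mu(dy)$. Here $\alpha\in(0,1)$, $g:[0,1]\to\mathbb{R}$ is a measurable function, and $\Lambda_1$ is a probability measure on $\Theta_1$. (Under the hypotheses every optimal rule $\delta^*$ satisfies $p(\theta;\delta^* )\in(0,1)$ for all $\theta\in\Theta$, so $g'(p(\theta;\delta^* ))$ is well defined.) *)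

(* Defs.v *)
From HB Require Import structures.
From mathcomp Require Import all_boot all_order all_algebra.
From mathcomp Require Import all_classical all_reals all_analysis.

Set Implicit Arguments.
Unset Strict Implicit.
Unset Printing Implicit Defensive.

Import Order.TTheory GRing.Theory Num.Theory.
Import numFieldNormedType.Exports.

Local Open Scope classical_set_scope.
Local Open Scope ring_scope.

(* R^d with its Borel sigma-algebra. *)
Definition borel_rV (R : realType) (d : nat) :=
  g_sigma_algebraType (@open 'rV[R]_d).

(* An arbitrary subset A of R^d, as a type. The proof of non-emptiness is only
   there because measurable types are pointed. *)
Definition subset_rV (R : realType) (d : nat) (A : set 'rV[R]_d)
  (A0 : A !=set0) : Type := set_type A.

HB.instance Definition _ (R : realType) (d : nat) (A : set 'rV[R]_d)
  (A0 : A !=set0) := Choice.copy (subset_rV A0) (set_type A).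

HB.instance Definition _ (R : realType) (d : nat) (A : set 'rV[R]_d)
  (A0 : A !=set0) := isPointed.Build (subset_rV A0)
    (exist _ (projT1 (cid A0)) (mem_set (projT2 (cid A0)))).

(* A with the Borel sigma-algebra of its subspace topology; A itself need not
   be a Borel subset of R^d. *)
Definition borel_subset (R : realType) (d : nat) (A : set 'rV[R]_d)
  (A0 : A !=set0) := g_sigma_algebraType (@open (set_type A) : set (set (subset_rV A0))).

Section testing.
Context {R : realType} {d1 : nat} {dY : measure_display}
  {Y : measurableType dY}.
Variables (mu : {measure set Y -> \bar R}) (f : 'rV[R]_d1 -> Y -> R).

Definition is_density (h : Y -> R) : Prop :=
  [/\ measurable_fun setT h, forall y, 0 <= h y
    & (\int[mu]_y (h y)%:E = 1)%E].

Definition law (theta : 'rV[R]_d1) : set Y -> \bar R :=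
  fun A => (\int[mu]_(y in A) (f theta y)%:E)%E.

Definition decision_rule (delta : Y -> R) : Prop :=
  measurable_fun setT delta /\ forall y, 0 <= delta y <= 1.

Definition power (delta : Y -> R) (theta : 'rV[R]_d1) : R :=
  \int[mu]_y (delta y * f theta y).

Definition size_on (Theta0 : set 'rV[R]_d1) (delta : Y -> R) : R :=
  sup [set power delta theta | theta in Theta0].

Definition feasible (Theta0 : set 'rV[R]_d1) (alpha : R) (delta : Y -> R) :
  Prop := decision_rule delta /\ size_on Theta0 delta <= alpha.

Definition objective (Theta1 : set 'rV[R]_d1)
    (Lambda1 : probability (borel_rV R d1) R) (g : R -> R) (delta : Y -> R) :
    R :=
  \int[Lambda1]_(theta in Theta1) g (power delta theta).

Definition optimal (Theta0 Theta1 : set 'rV[R]_d1) (alpha : R)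
    (Lambda1 : probability (borel_rV R d1) R) (g : R -> R) (delta : Y -> R) :
    Prop :=
  feasible Theta0 alpha delta /\
  forall delta', feasible Theta0 alpha delta' ->
    objective Theta1 Lambda1 g delta' <= objective Theta1 Lambda1 g delta.

(* The next two integrals may be +oo at exceptional y, hence their type. *)
Definition weighted_mixture (Theta1 : set 'rV[R]_d1)
    (Lambda1 : probability (borel_rV R d1) R) (g : R -> R) (delta : Y -> R)
    (y : Y) : \bar R :=
  (\int[Lambda1]_(theta in Theta1)
     (g^`()%classic (power delta theta) * f theta y)%:E)%E.

Definition mixture (Theta0 : set 'rV[R]_d1)
    (Lambda0 : probability (borel_rV R d1) R) (y : Y) : \bar R :=
  (\int[Lambda0]_(theta in Theta0) (f theta y)%:E)%E.

End testing.

(* Main.v *)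
Require Import Defs.
From HB Require Import structures.
From mathcomp Require Import all_boot all_order all_algebra.
From mathcomp Require Import all_classical all_reals all_analysis.
From mathcomp Require Import measurable_realfun ring lra.

Set Implicit Arguments.
Unset Strict Implicit.
Unset Printing Implicit Defensive.

Import Order.TTheory GRing.Theory Num.Theory.
Import numFieldNormedType.Exports.

Local Open Scope classical_set_scope.
Local Open Scope ring_scope.

(** Write p(t; delta) for the power and G(delta) for the objective. The idea is
    that an optimal rule satisfies a first-order condition with a multiplier
    measure on Theta0, and that this condition is a linear testing problem whose
    solutions are threshold rules.

    Compactness. Power functions are 1-Lipschitz for the L^1 distance of the
    densities ([power_lipschitz]), whatever the rule, so that convergence of
    powers at a dense set of parameters is uniform on the compact set Theta.
    After a diagonal extraction, the rules whose powers are close to the limit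
    values at the first n dense points form decreasing convex classes, and the
    parallelogram identity makes near-minimisers of a weighted L^2 norm in these
    classes converge almost everywhere ([convex_classes_cvg_ae]). Since the laws
    are mutually absolutely continuous, one weight f_t serves for all parameters.
    Hence every sequence of rules has a subsequence whose powers converge,
    uniformly on Theta, to the power of a rule ([power_sequentially_compact]).

    Multipliers. For x_0, x_1, ... dense in Theta0, let delta_n nearly maximise
      G(delta) - (n / 2) sum_(i < n) max(p(x_i; delta) - alpha, 0)^2.
    A small step from delta_n towards a rule d gives
      (difference quotient of G at delta_n towards d)
        <= sum_(i < n) c_(n,i) (p(x_i; d) - p(x_i; delta_n)) + O(1 / n)
    with c_(n,i) = n max(p(x_i; delta_n) - alpha, 0) ([penalized_sequence]).
    A limit rule delta0 is feasible and optimal, and its power takes values in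
    some [a, b] inside ]0, 1[ ([limit_power_interior]), where g' is bounded. With
    d = 0 the inequality then bounds the total masses of the multipliers, so that
    the measures sum_i c_(n,i) delta_(x_i) have a limit kappa Lambda0
    ([bounded_discrete_measures_cvg]). The limit of the inequality is
      int_Theta1 g'(p(t; delta0)) (p(t; d) - p(t; delta0)) Lambda1(dt)
        <= kappa (int_Theta0 p(t; d) Lambda0(dt) - alpha)
    for every rule d ([limit_multipliers]).

    Threshold form. With d = delta0 this gives complementary slackness. By
    Tonelli, delta0 then maximises int d (H - kappa F) dmu over all rules d, where
    H and F are the two mixtures of densities in the theorem. Comparison with the
    rule that is 1 where H > kappa F, 0 where H < kappa F and delta0 elsewhere
    shows that delta0 equals that rule almost everywhere ([threshold_rule_ae]),
    and replacing delta0 by it changes no power. If the size were less than alpha,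
    slackness would give kappa = 0, and d = 1 would contradict g' > 0. *)

(** * Limits and bounds of integrals *)

Lemma Rintegral_cvg {R : realType} {d} {T : measurableType d}
    (mu : {measure set T -> \bar R}) (D : set T) (F : nat -> T -> R)
    (G g : T -> R) :
  measurable D -> (forall n, measurable_fun D (F n)) -> measurable_fun D G ->
  mu.-integrable D (EFin \o g) ->
  {ae mu, forall x, D x -> F n x @[n --> \oo] --> G x} ->
  (forall n x, D x -> `|F n x| <= g x) ->
  \int[mu]_(x in D) F n x @[n --> \oo] --> \int[mu]_(x in D) G x.
Proof.
move=> mD mF mG ig FG Fg.
have [] := @dominated_convergence _ _ _ mu D mD (fun n => EFin \o F n)
  (EFin \o G) (EFin \o g).
- by move=> n; exact/measurable_EFinP.
- exact/measurable_EFinP.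
- apply: filterS FG => x + Dx => /(_ Dx) FG.
  by apply: cvg_EFin; first exact: nearW.
- exact: ig.
- by apply: aeW => x n Dx; rewrite lee_fin Fg.
move=> iG _ cF.
apply: fine_cvg; rewrite fineK; last exact: integrable_fin_num.
exact: cF.
Qed.

Lemma integrable_bounded_probability {R : realType} {d} {T : measurableType d}
    (P : probability T R) (A : set T) (F : T -> R) (M : R) :
  measurable A -> measurable_fun A F -> (forall t, A t -> `|F t| <= M) ->
  P.-integrable A (EFin \o F).
Proof.
move=> mA mF FM.
apply: (le_integrable mA _ _ (finite_measure_integrable_cst P M mA)).
  exact/measurable_EFinP.
by move=> t At; rewrite lee_fin (le_trans (FM _ At))// ler_norm.
Qed.

Lemma Rintegral_cst_probability {R : realType} {d} {T : measurableType d}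
    (P : probability T R) (A : set T) :
  measurable A -> P A = 1%E -> forall c : R, \int[P]_(t in A) c = c.
Proof. by move=> mA PA c; rewrite Rintegral_cst//= PA/= mulr1. Qed.

(** * Diagonal extraction and the Cantor space *)

(** A filter is closed under finite intersections only, so countably many
    eventual properties hold together just for the indices of bounded code. *)
Lemma near_initial_segment (I : countType) (T : Type) (F : set_system T)
    (P : I -> T -> Prop) n : Filter F ->
  (forall i, \forall x \near F, P i x) ->
  \forall x \near F, forall i, (pickle i < n)%N -> P i x.
Proof.
move=> FF FP; elim: n => [|n IH]; first by near=> x => i; rewrite ltn0.
have [[j nj]|jn] := pselect (exists j : I, pickle j = n); last first.
  apply: filterS IH => x IHx i.
  rewrite ltnS leq_eqVlt => /predU1P[ni|]; last exact: IHx.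
  by exfalso; apply: jn; exists i.
apply: filterS2 (FP j) IH => x xj IHx i.
rewrite ltnS leq_eqVlt => /predU1P[ni|]; last exact: IHx.
suff -> : i = j by [].
by apply: (pcan_inj (@pickleK I)); rewrite ni nj.
Unshelve. all: end_near. Qed.

Lemma near_coordinates (I : countType) (X : I -> topologicalType)
    (l : prod_topology X) (U : forall i, set (X i)) n :
  (forall i, nbhs (l i) (U i)) ->
  \forall f \near l, forall i, (pickle i < n)%N -> U i (f i).
Proof.
move=> lU; apply: (@near_initial_segment I _ (nbhs l) (fun i f => U i (f i)) n _).
move=> i; exact: (@proj_continuous I X i l (U i) (lU i)).
Qed.

(** The diagonal argument, with the compactness of a product of segments in the
    place of nested extractions: for a cluster point l, the rank s n is any m
    beyond n such that u m is within 1 / (n + 1) of l on the first n indices.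
    The map s need not be increasing; n <= s n is enough to pass to limits. *)
Lemma bounded_subsequence (R : realType) (I : countType) (u : nat -> I -> R)
    (B : I -> R) :
  (forall n i, `|u n i| <= B i) ->
  exists (s : nat -> nat) (l : I -> R),
    (forall n, (n <= s n)%N) /\ forall i, u (s n) i @[n --> \oo] --> l i.
Proof.
move=> uB.
pose PT : topologicalType := prod_topology (fun _ : I => (R : topologicalType)).
have : compact [set f : PT |
    forall i, `[- B i, B i]%classic (f i)].
  apply: (@tychonoff I (fun=> R) (fun i => `[- B i, B i]%classic)) => i.
  exact: segment_compact.
move=> /(_ (u n @[n --> \oo]) _) [].
  exists 0%N => // n _ i /=; rewrite in_itv/=; have := uB n i.
  by rewrite ler_norml.
move=> l [_ lcl].
have near_l e : 0 < e -> forall n, \forall f \near l,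
    forall i, (pickle i < n)%N -> ball (l i) e (f i).
  move=> e0 n; apply: (@near_coordinates I (fun=> (R : topologicalType)) l
    (fun i => ball (l i) e)) => i.
  exact: nbhsx_ballx.
have pick n : exists m, (n <= m)%N /\
    forall i, (pickle i < n)%N -> `|u m i - l i| < n.+1%:R^-1.
  have [] := lcl [set u m | m in [set m | (n <= m)%N]] _ _
    (near_l n.+1%:R^-1 _ n).
  - by exists n => // m /= nm; exists m.
  - by rewrite invr_gt0.
  - move=> _ [[m nm <-] H]; exists m; split => // i /H.
    by rewrite /ball/= distrC.
have [s sP] := choice pick.
exists s, l; split => [n|i]; first by have [] := sP n.
apply/cvgrPdist_lt => e e0.
near=> n; rewrite distrC.
have [_ /(_ i) sn] := sP n.
apply: lt_trans (sn _) _.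
  by near: n; exact: nbhs_infty_gt.
near: n; exact: near_infty_natSinv_lt (PosNum e0).
Unshelve. all: end_near. Qed.

(** The sets of all z' with [agree k z z'] are the basic neighbourhoods of z in
    the Cantor space, which is how continuity is expressed below. *)
Definition agree (k : nat) (z z' : nat -> bool) :=
  forall i, (i < k)%N -> z i = z' i.

Lemma near_agree (z : cantor_space) k : \forall z' \near z, agree k z z'.
Proof.
apply: (@near_coordinates nat (fun=> bool) z (fun i b => z i = b)) => i.
by apply: open_nbhs_nbhs; split => //; exact: discrete_open.
Qed.

Lemma cvg_agree (z : cantor_space) (s : nat -> cantor_space) :
  (forall k, agree k z (s k)) -> s k @[k --> \oo] --> z.
Proof.
move=> zs; apply/cvg_sup => i U [V [[W oW <-] Wz WU]].
apply: filterS WU _.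
exists i.+1 => // k /= ik; rewrite -(zs k i)//.
Qed.

(** The map from the Cantor space constructed below goes onto a space, so a
    compact subset has to be seen as a space of its own. *)
Lemma set_type_compact (X : topologicalType) (K : set X) :
  compact K -> compact [set: set_type K].
Proof.
move=> /compact_near_coveringP cK; apply/compact_near_coveringP.
move=> J F P FF near_P.
have Q : \near F, K `<=` (fun x => forall Kx : x \in K, P F (exist _ x Kx)).
  apply: (cK J F (fun i x => forall Kx : x \in K, P i (exist _ x Kx)) FF).
  move=> x Kx.
  have [[U V] /= [Ux FV] UVP] := near_P (exist _ x (mem_set Kx)) I.
  have [_ [[W oW <-] /= Wx] WU] := Ux.
  exists (W, V) => /=; first by split => //; exact: open_nbhs_nbhs.
  move=> [x' i] /= [Wx' Vi] Kx'.
  by apply: (UVP (exist _ x' Kx', i)) => /=; split => //; apply: WU.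
by apply: filterS Q => i KP [x Kx] _; apply: KP; rewrite inE in Kx.
Qed.

(** Every compact metrisable space is a continuous image of the Cantor space.
    Here the codes do the work of finer and finer partitions of K: points with a
    long common prefix are close, uniformly so by [cantor_uniform]. *)
Lemma cantor_param (R : realType) d (K : set 'rV[R]_d) :
  compact K -> K !=set0 ->
  exists phi : (nat -> bool) -> 'rV[R]_d,
    [/\ forall z, K (phi z), forall x, K x -> exists z, phi z = x &
      forall z U, nbhs (phi z) U ->
        exists k, forall z', agree k z z' -> U (phi z')].
Proof.
move=> cK K0.
have hT : hausdorff_space (set_type K).
  move=> x y cxy; apply: val_inj; apply: norm_hausdorff => A B nA nB.
  have [z [Az Bz]] := cxy (set_val @^-1` A) (set_val @^-1` B)
    (@initial_continuous _ _ set_val x _ nA) (@initial_continuous _ _ set_val y _ nB).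
  by exists (set_val z).
have [x0 Kx0] := K0.
pose pT := isPointed.Build (set_type K) (exist _ x0 (mem_set Kx0)).
pose pK : pseudoPMetricType R := HB.pack (set_type K) pT.
have [f cf] := @cantor_surj R pK (set_type_compact cK) hT.
exists (fun z => set_val (f z)); split => [z|x Kx|z U nU].
- exact: set_valP.
- have [z _ fz] := @surj _ _ _ _ f (exist _ x (mem_set Kx) : pK) I.
  by exists z; rewrite fz.
- apply: contrapT => /forallNP H.
  have {}H k : exists z', agree k z z' /\ ~ U (set_val (f z')).
    by have /existsNP[z' /not_implyP[? ?]] := H k; exists z'.
  have [s sP] := choice H.
  have sz : s k @[k --> \oo] --> (z : cantor_space).
    by apply: cvg_agree => k; have [] := sP k.
  have := sz (f @^-1` (set_val @^-1` U)).
  case=> [|N _ NP]; last by have [_] := sP N; apply; apply: NP => /=.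
  by apply: cf; apply: (@initial_continuous _ _ set_val).
Qed.

(** Uniform continuity on the Cantor space, for a general pseudo-distance D: it
    serves for the variations of a continuous function of the coded point and for
    the L^1 distance between coded densities. *)
Lemma cantor_uniform (R : realType) (D : (nat -> bool) -> (nat -> bool) -> R) :
  (forall z z', D z z' = D z' z) ->
  (forall x y z, D x z <= D x y + D y z) ->
  (forall z e, 0 < e -> exists k, forall z', agree k z z' -> D z z' < e) ->
  forall e, 0 < e -> exists k, forall z z', agree k z z' -> D z z' < e.
Proof.
move=> Dsym Dtri Dcont e e0.
pose P (k : nat) (z : cantor_space) := forall z', agree k z z' -> D z z' < e.
have [] := (compact_near_coveringP _).1 cantor_space_compact _ \oo P _.
- move=> z _; have e20 : 0 < e / 2 by rewrite divr_gt0.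
  have [k0 k0P] := Dcont z (e / 2) e20.
  exists ([set z' | agree k0 z z'], [set k | (k0 <= k)%N]) => /=.
    by split; [exact: near_agree|exists k0].
  move=> [z' k] /= [zz' k0k] z'' z'z''.
  rewrite (le_lt_trans (Dtri _ z _))// [e]splitr ltrD// ?k0P//.
    by rewrite Dsym k0P.
  by move=> i ik; rewrite zz'// z'z''// (leq_trans ik).
- move=> N _ NP; exists N => z z' zz'.
  exact: (NP N (leqnn _) z I z' zz').
Qed.

(** The points whose codes are eventually false are dense and countably many.
    Integers that code no word are sent to the empty one. *)
Lemma dense_sequence (R : realType) d (K : set 'rV[R]_d) :
  compact K -> K !=set0 ->
  exists x : nat -> 'rV[R]_d, (forall i, K (x i)) /\
    forall t U, K t -> nbhs t U -> exists i, U (x i).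
Proof.
move=> cK K0; have [phi [phiK phi_surj phi_cont]] := cantor_param cK K0.
exists (fun i => phi (nth false (odflt [::] (unpickle i)))); split => //.
move=> _ U /phi_surj[z <-] /phi_cont[k kP]; exists (pickle (mkseq z k)).
by rewrite pickleK; apply: kP => i ik; rewrite nth_mkseq.
Qed.

(** * Limits of finitely supported measures *)

(** A tree of masses m, additive over the two extensions of each word, is realised
    as the law of the prefixes of a random sequence of digits, which are computed
    from a uniform variable u. *)
Section tree_measure.
Context {R : realType}.
Variable m : seq bool -> R.
Hypothesis m_ge0 : forall w, 0 <= m w.
Hypothesis m_nil : m [::] = 1.
Hypothesis m_split : forall w, m w = m (rcons w false) + m (rcons w true).

(** The first k digits w of u and the remainder u - a, where [a, a + m w[ is the
    interval of those u of [0, 1[ whose digits begin with w. Its first part, of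
    length m (rcons w false), gives the next digit false, the rest true. *)
Fixpoint quantile_state (u : R) (k : nat) : seq bool * R :=
  if k is k'.+1 then
    let: (w, r) := quantile_state u k' in
    let b := m (rcons w false) <= r in
    (rcons w b, if b then r - m (rcons w false) else r)
  else ([::], u).

Definition quantile_digit (u : R) (k : nat) : bool :=
  m (rcons (quantile_state u k).1 false) <= (quantile_state u k).2.

Lemma quantile_state1 u k : (quantile_state u k).1 = mkseq (quantile_digit u) k.
Proof.
elim: k => [//|k IH]; rewrite mkseqS -IH/= /quantile_digit.
by case: (quantile_state u k).
Qed.

Lemma quantile_state2 u k : (quantile_state u k.+1).2 =
  (quantile_state u k).2 - (if quantile_digit u k
     then m (rcons (quantile_state u k).1 false) else 0).
Proof.
rewrite /= /quantile_digit; case: (quantile_state u k) => w r /=.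
by case: ifP => _; rewrite ?subr0.
Qed.

Let cell w := [set u : R | mkseq (quantile_digit u) (size w) = w].

(** Each digit cuts the interval of its prefix in two, so the cell of w is an
    interval of length m w. Measurability and the value of the remainder are
    claimed for all real u, not just in [0, 1[, as the cell is a subset of the
    whole line. *)
Lemma quantile_cell w : exists a, [/\ 0 <= a, a + m w <= 1, measurable (cell w),
  forall u, cell w u -> (quantile_state u (size w)).2 = u - a &
  forall u, 0 <= u < 1 -> cell w u <-> a <= u < a + m w].
Proof.
elim/last_ind: w => [|w b [a [a0 am mw rw cw]]].
  exists 0; split => //; rewrite ?m_nil ?add0r//.
    by rewrite (_ : cell [::] = setT)//; apply/seteqP.
  by move=> u _; rewrite subr0.
have cellS u : cell (rcons w b) u <->
    cell w u /\ (m (rcons w false) <= u - a) = b.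
  rewrite /cell/= size_rcons mkseqS; split.
    move=> /rcons_inj [ww wb]; split => //.
    by rewrite -rw// -wb /quantile_digit quantile_state1 ww.
  move=> [ww wb]; rewrite ww; congr rcons.
  by rewrite /quantile_digit quantile_state1 ww rw.
pose a' := if b then a + m (rcons w false) else a.
have mS : m w = m (rcons w false) + m (rcons w true) by exact: m_split.
have [m1 m2] : 0 <= m (rcons w false) /\ 0 <= m (rcons w true) by [].
exists a'; rewrite /a'; split.
- by case: b {cellS a'}; rewrite ?addr_ge0.
- by case: b {cellS a'}; lra.
- have -> : cell (rcons w b) = cell w `&`
      (if b then `[a + m (rcons w false), +oo[%classic
       else `]-oo, a + m (rcons w false)[%classic).
    apply/seteqP; split => u /=.
      move=> /cellS[wu <-]; split => //.
      by case: ifPn => /=; rewrite in_itv/= ?andbT; lra.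
    move=> [wu bu]; apply/cellS; split => //.
    by case: b bu {cellS a'} => /=; rewrite in_itv/= ?andbT; lra.
  by apply: measurableI => //; case: ifP => _; exact: measurable_itv.
- move=> u /cellS [wu bu]; rewrite size_rcons quantile_state2 rw//.
  have -> : quantile_digit u (size w) = b.
    by rewrite -bu /quantile_digit quantile_state1 rw// wu.
  by rewrite quantile_state1 wu; case: ifP => _; lra.
- move=> u u01; rewrite cellS; move: (cw u u01) => {}cw.
  split.
    by move=> [/cw au bu]; case: b bu {cellS a'}; lra.
  move=> au; split; first by apply/cw; case: b au {cellS a'}; lra.
  by case: b au {cellS a'}; lra.
Qed.

Lemma uniform_prob_itvco (a b : R) : 0 <= a -> a <= b -> b <= 1 ->
  uniform_prob (@ltr01 R) `[a, b[%classic = (b - a)%:E.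
Proof.
move=> a0 ab b1; rewrite /uniform_prob.
rewrite (eq_integral (fun=> 1%E)).
  rewrite integral_cst//= mul1e lebesgue_measure_itv/= lte_fin.
  by move: ab; rewrite le_eqVlt => /predU1P[->|->]; rewrite ?ltxx ?subrr// EFinB.
move=> u; rewrite inE/= in_itv/= => /andP[au ub].
rewrite /uniform_pdf ifT; first by rewrite subr0 invr1.
by apply/andP; split; lra.
Qed.

Lemma uniform_prob_cell w :
  measurable (cell w) /\ uniform_prob (@ltr01 R) (cell w) = (m w)%:E.
Proof.
have [a [a0 am mw _ cw]] := quantile_cell w; split => //.
pose P : probability _ R := uniform_prob (@ltr01 R).
have mI : measurable (`[0, 1[%classic : set R) by exact: measurable_itv.
have PI0 : P (~` `[0, 1[%classic) = 0%E.
  by rewrite probability_setC// [X in (1 - X)%E]uniform_prob_itvco// subr0 subee.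
rewrite -[LHS]/(P (cell w)) (measureDI P mw mI).
rewrite [X in (X + _)%E](_ : _ = 0%E); last first.
  apply/eqP; rewrite -measure_le0 -PI0 le_measure// ?inE//.
  - exact: measurableD.
  - exact: measurableC.
rewrite add0e (_ : _ `&` _ = `[a, a + m w[%classic).
  by rewrite [LHS]uniform_prob_itvco// ?lerDl// addrC addKr.
apply/seteqP; split => u /=; rewrite !in_itv/=.
  by move=> [/cw H u01]; exact: H.
move=> au; have u01 : 0 <= u < 1 by move: (m_ge0 w); lra.
by split => //; exact/cw.
Qed.

End tree_measure.

Lemma borel_rV_open (R : realType) d (O : set 'rV[R]_d) : open O ->
  measurable (O : set (borel_rV R d)).
Proof. by move=> oO; exact: sub_sigma_algebra. Qed.

Lemma borel_rV_closed (R : realType) d (K : set 'rV[R]_d) : closed K ->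
  measurable (K : set (borel_rV R d)).
Proof.
move=> cK; rewrite -[K]setCK; apply: measurableC; apply: borel_rV_open.
exact: closed_openC.
Qed.

Lemma compact_closed_rV (R : realType) d (K : set 'rV[R]_d) :
  compact K -> closed K.
Proof. by apply: compact_closed; exact: norm_hausdorff. Qed.

Lemma within_continuous_borel (R : realType) d (K : set 'rV[R]_d)
    (psi : 'rV[R]_d -> R) :
  closed K -> {within K, continuous psi} ->
  measurable_fun (K : set (borel_rV R d)) psi.
Proof.
move=> cK /continuousP cpsi.
apply: (measurability _ (RGenOpens.measurableE R)).
move=> _ [_ [a [b ->] <-]].
have : open (psi @^-1` `]a, b[%classic : set (subspace K)).
  by apply: cpsi; exact: interval_open.
move=> /open_subspaceP[V oV VK].
rewrite setIC -VK; apply: measurableI; first exact: borel_rV_open.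
exact: borel_rV_closed.
Qed.

Section tree_law.
Context {R : realType}.
Variable m : seq bool -> R.
Hypothesis m_ge0 : forall w, 0 <= m w.
Hypothesis m_nil : m [::] = 1.
Hypothesis m_split : forall w, m w = m (rcons w false) + m (rcons w true).
Let P : probability (measurableTypeR R) R := uniform_prob (@ltr01 R).
Let Z := quantile_digit m.

(** A function of the first k digits is a step function on the cells, whose
    probabilities are the masses. *)
Lemma expectation_prefix (F : seq bool -> R) k :
  measurable_fun setT (fun u : measurableTypeR R => F (mkseq (Z u) k)) /\
  \int[P]_u F (mkseq (Z u) k) = \sum_(w : k.-tuple bool) m w * F w.
Proof.
pose cell w := [set u : measurableTypeR R | mkseq (Z u) (size w) = w].
have mc w : measurable (cell w) by case: (uniform_prob_cell m_ge0 m_nil m_split w).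
have Pc w : P (cell w) = (m w)%:E by case: (uniform_prob_cell m_ge0 m_nil m_split w).
have FE u : F (mkseq (Z u) k) = \sum_(w : k.-tuple bool) F w * \1_(cell w) u.
  rewrite (bigD1 [tuple of mkseq (Z u) k])//= indicE mem_set/=; last first.
    by rewrite /cell/= size_mkseq.
  rewrite mulr1 big1 ?addr0// => w /eqP wZ.
  rewrite indicE memNset ?mulr0// /cell/= size_tuple => wE; apply: wZ.
  exact/val_inj.
have mF w : measurable_fun setT (fun u : measurableTypeR R => F w * \1_(cell w) u).
  by apply: measurable_funM => //; exact: measurable_indic.
have i1 w : P.-integrable setT (EFin \o \1_(cell w)).
  by have := @integrable_indic _ _ R P (cell w) (mc w).
have iF w : P.-integrable setT (fun u => (F w * \1_(cell w) u)%:E).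
  exact: (integrableZl measurableT (F w) (i1 w)).
split.
  apply: (eq_measurable_fun (fun u => \sum_(w : k.-tuple bool) F w * \1_(cell w) u)).
    by move=> u _; rewrite FE.
  by apply: measurable_sum => w; exact: mF.
rewrite /Rintegral.
under eq_integral do rewrite FE -sumEFin.
rewrite integral_sum//.
rewrite (eq_bigr (fun w : k.-tuple bool => (m w * F w)%:E)); last first.
  move=> w _; under eq_integral do rewrite EFinM.
  rewrite integralZl//; last exact: (i1 w).
  rewrite integral_indic//.
  by rewrite setIT [X in (_ * X)%E](Pc w) -EFinM mulrC.
by rewrite sumEFin.
Qed.

(** The law of phi of the random digits. The sums over words of length k are the
    expectations of psi at the sequences truncated after k digits, so they
    converge by dominated convergence. *)
Lemma tree_law d (K : set 'rV[R]_d) (phi : (nat -> bool) -> 'rV[R]_d) :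
  compact K -> (forall z, K (phi z)) ->
  (forall z U, nbhs (phi z) U ->
     exists k, forall z', agree k z z' -> U (phi z')) ->
  exists Lambda : probability (borel_rV R d) R,
    Lambda K = 1%E /\
    forall psi : 'rV[R]_d -> R, {within K, continuous psi} ->
      \sum_(w : k.-tuple bool) m w * psi (phi (nth false w)) @[k --> \oo] -->
      \int[Lambda]_(t in K) psi t.
Proof.
move=> cK phiK phi_cont.
have clK := compact_closed_rV cK.
pose cell w := [set u : measurableTypeR R | mkseq (Z u) (size w) = w].
have mc w : measurable (cell w) by case: (uniform_prob_cell m_ge0 m_nil m_split w).
pose X (u : measurableTypeR R) : borel_rV R d := phi (Z u).
have mX : measurable_fun setT X.
  apply: (@measurability _ _ _ _ setT X (@open 'rV[R]_d)) => //.
  move=> _ [G oG <-]; rewrite setTI.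
  (* a prefix of the digits decides that X u lies in the open set G *)
  have -> : X @^-1` G = \bigcup_(w : seq bool)
      (if `[< forall z, mkseq z (size w) = w -> G (phi z) >] then cell w else set0).
    apply/seteqP; split => u /=.
      move=> GX; have [k kP] := phi_cont (Z u) G (open_nbhs_nbhs (conj oG GX)).
      exists (mkseq (Z u) k) => //.
      rewrite ifT; first by rewrite /cell/= size_mkseq.
      apply/asboolP => z; rewrite size_mkseq => zk; apply: kP => i ik.
      by rewrite -(nth_mkseq false (Z u) ik) -zk nth_mkseq.
    move=> [w _]; case: asboolP => // H wu; exact: H.
  apply: countable_bigcupT_measurable => [|w]; first exact: countableP.
  by case: asboolP.
pose mfX := isMeasurableFun.Build _ _ _ _ X mX.
pose pX : {mfun _ >-> borel_rV R d} := MeasurableFun.Pack (MeasurableFun.Class mfX).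
exists (distribution P pX); split.
  rewrite /distribution /pushforward/= (_ : X @^-1` K = setT) ?probability_setT//.
  by apply/seteqP; split => // u _; exact: phiK.
move=> psi cpsi.
have K0 : K !=set0 by exists (phi (fun=> false)).
have [M MP] : exists M, forall t, K t -> `|psi t| <= M.
  have [c1 _ c1P] := EVT_max_rV K0 cK cpsi.
  have [c2 _ c2P] := EVT_min_rV K0 cK cpsi.
  exists (Num.max `|psi c1| `|psi c2|) => t Kt.
  have := c1P t (mem_set Kt); have := c2P t (mem_set Kt).
  rewrite le_max; have [_ _ psi1|_ psi2 _] := ger0P (psi t).
    by rewrite (le_trans psi1)// ler_norm.
  apply/orP; right; apply: (@le_trans _ _ (- psi c2)); first by rewrite lerN2.
  by rewrite -normrN ler_norm.
have mpsi := within_continuous_borel clK cpsi.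
have mK : measurable (K : set (borel_rV R d)) by exact: borel_rV_closed.
have mpsiX : measurable_fun setT (fun u : measurableTypeR R => psi (X u)).
  apply: (measurable_comp mK _ mpsi mX) => _ [u _ <-]; exact: phiK.
have iM : P.-integrable setT (EFin \o cst M).
  exact: finite_measure_integrable_cst.
have ipsiX : P.-integrable setT (EFin \o (fun u => psi (X u))).
  apply: le_integrable iM => //; first exact/measurable_EFinP.
  by move=> u _; rewrite lee_fin (le_trans (MP _ (phiK _)))// ler_norm.
have psiKX : (EFin \o (psi \_ K)) \o pX = EFin \o (fun u => psi (X u)).
  by apply/funext => u /=; rewrite patchE mem_set//; exact: phiK.
have -> : \int[distribution P pX]_(t in K) psi t = \int[P]_u psi (X u).
  rewrite Rintegral_mkcond /Rintegral integral_distribution ?psiKX//.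
  by apply/measurable_EFinP; apply/(measurable_restrictT _ mK).
have -> : (fun k => \sum_(w : k.-tuple bool) m w * psi (phi (nth false w))) =
    (fun k => \int[P]_u psi (phi (nth false (mkseq (Z u) k)))).
  apply/funext => k.
  by rewrite (expectation_prefix (fun w => psi (phi (nth false w))) k).2.
apply: (@Rintegral_cvg _ _ _ P setT _ _ (fun=> M)) => //.
- by move=> n; exact: (expectation_prefix (fun w => psi (phi (nth false w))) n).1.
- apply: aeW => u _.
  have /subspace_continuousP/(_ _ (phiK (Z u))) /cvgrPdist_lt cZ := cpsi.
  apply/cvgrPdist_lt => e /cZ; rewrite near_withinE => /phi_cont [k0 k0P].
  exists k0 => // k /= kk; apply: k0P => // i ik.
  by rewrite nth_mkseq// (leq_trans ik).
- by move=> n u _; exact: MP.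
Qed.

End tree_law.

(** Grouping the atoms by the first k digits of their codes turns a sum over
    points, whose number varies with the measure, into a sum over the words of
    length k. *)
Lemma sum_by_prefix (R : realType) (I : finType) (c : I -> R)
    (z : I -> nat -> bool) (F : seq bool -> R) k :
  \sum_(w : k.-tuple bool)
     (\sum_(i | mkseq (z i) (size w) == w) c i) * F w =
  \sum_i c i * F (mkseq (z i) k).
Proof.
under eq_bigr do rewrite mulr_suml.
rewrite (exchange_big_dep xpredT)//=; apply: eq_bigr => i _.
rewrite (big_pred1 [tuple of mkseq (z i) k])//= => w.
by rewrite /= size_tuple -val_eqE/= eq_sym.
Qed.

Lemma sum_prefix_split (R : realType) (I : finType) (c : I -> R)
    (z : I -> nat -> bool) (w : seq bool) :
  \sum_(i | mkseq (z i) (size w) == w) c i =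
  \sum_(i | mkseq (z i) (size (rcons w false)) == rcons w false) c i +
  \sum_(i | mkseq (z i) (size (rcons w true)) == rcons w true) c i.
Proof.
rewrite (bigID (fun i => z i (size w))) addrC/=; congr (_ + _);
  apply: eq_bigl => i; rewrite size_rcons mkseqS eqseq_rcons; congr (_ && _);
  by case: (z i (size w)).
Qed.

(** Sequential compactness of these measures for weak convergence. The masses of
    the sets of codes with a given prefix converge along a subsequence; the limits
    are again additive over words and [tree_law] turns them into a measure. A
    continuous psi is uniformly continuous in the code, so cutting the codes after
    k digits costs an error that is small uniformly in n, and the limits in n and
    in k may be exchanged. *)
Lemma bounded_discrete_measures_cvg (R : realType) d (K : set 'rV[R]_d)
    (x : nat -> 'rV[R]_d) (N : nat -> nat) (c : nat -> nat -> R) (B : R) :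
  compact K -> (forall i, K (x i)) -> (forall n i, 0 <= c n i) ->
  (forall n, \sum_(i < N n) c n i <= B) ->
  exists (s : nat -> nat) (kappa : R) (Lambda : probability (borel_rV R d) R),
    [/\ forall n, (n <= s n)%N, 0 <= kappa, Lambda K = 1%E &
      forall psi : 'rV[R]_d -> R, {within K, continuous psi} ->
        \sum_(i < N (s n)) c (s n) i * psi (x i) @[n --> \oo] -->
        kappa * \int[Lambda]_(t in K) psi t].
Proof.
move=> cK Kx c0 cB.
have K0 : K !=set0 by exists (x 0%N).
have [phi [phiK phi_surj phi_cont]] := cantor_param cK K0.
have [z zP] := choice (fun i => phi_surj _ (Kx i)).
pose mass n (w : seq bool) := \sum_(i < N n | mkseq (z i) (size w) == w) c n i.
have mass0 n w : 0 <= mass n w by apply: sumr_ge0.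
have massB n w : `|mass n w| <= B.
  rewrite ger0_norm//; apply: le_trans (cB n).
  rewrite [leRHS](bigID (fun i : 'I__ => mkseq (z i) (size w) == w))/=.
  by rewrite lerDl sumr_ge0.
have [s [M [s_ge s_cvg]]] := bounded_subsequence massB.
have M0 w : 0 <= M w.
  rewrite -(cvg_lim _ (s_cvg w))//.
  apply: limr_ge; first by apply/cvg_ex; exists (M w); exact: s_cvg.
  by apply: nearW => n; exact: mass0.
have M_split w : M w = M (rcons w false) + M (rcons w true).
  apply: (@cvg_unique _ _ (fmap (fun n => mass (s n) w) \oo)) => //.
    exact: s_cvg.
  rewrite (_ : (fun n => _) = (fun n => mass (s n) (rcons w false) +
    mass (s n) (rcons w true))); first by apply: cvgD; exact: s_cvg.
  by apply/funext => n; exact: sum_prefix_split.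
(* If the limit is null, its normalisation is replaced by the unit mass on the
   sequence whose digits are all false. *)
have [m [m0 m_nil m_split Mm]] : exists m : seq bool -> R,
    [/\ forall w, 0 <= m w, m [::] = 1,
     forall w, m w = m (rcons w false) + m (rcons w true) &
     forall w, M w = M [::] * m w].
  have [M00|M00] := eqVneq (M [::]) 0.
    exists (fun w => (~~ has id w)%:R); split => // w.
      by rewrite !has_rcons/= addr0.
    rewrite M00 mul0r; elim/last_ind: w => [//|w b IH].
    have := M_split w; have := M0 (rcons w true); have := M0 (rcons w false).
    by rewrite IH; case: b; lra.
  exists (fun w => M w / M [::]); split => [w|||w].
  - by rewrite divr_ge0.
  - by rewrite divff.
  - by move=> w; rewrite M_split mulrDl.
  - by rewrite mulrC divfK.
have [Lambda [LK LP]] := tree_law m0 m_nil m_split cK phiK phi_cont.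
exists s, (M [::]), Lambda; split => // psi cpsi.
pose F w := psi (phi (nth false w)).
have psi_unif e : 0 < e -> exists k, forall z z', agree k z z' ->
    `|psi (phi z) - psi (phi z')| < e.
  move: e; apply: cantor_uniform => [z1 z2|z1 z2 z3|z1 e e0].
  - exact: distrC.
  - exact: ler_distD.
  - have /subspace_continuousP/(_ _ (phiK z1)) /cvgrPdist_lt/(_ e e0) := cpsi.
    rewrite near_withinE => /phi_cont [k kP].
    by exists k => z' /kP; apply; exact: phiK.
have discrete_prefix n e k : (forall z z', agree k z z' ->
      `|psi (phi z) - psi (phi z')| < e) ->
    `|\sum_(i < N n) c n i * psi (x i) -
      \sum_(w : k.-tuple bool) mass n w * F w| <= B * e.
  move=> kP; rewrite (@sum_by_prefix _ 'I_(N n) (c n) (fun i => z i) F k).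
  rewrite -sumrB (le_trans (ler_norm_sum _ _ _))//.
  have e0 : 0 <= e by apply: ltW; apply: le_lt_trans (kP (z 0%N) (z 0%N) _).
  apply: (@le_trans _ _ (\sum_(i < N n) c n i * e)); last first.
    by rewrite -mulr_suml ler_wpM2r.
  apply: ler_sum => i _; rewrite -mulrBr normrM (ger0_norm (c0 _ _)).
  rewrite ler_wpM2l// -zP ltW//; apply: kP => j jk.
  by rewrite nth_mkseq.
have prefix_cvg k : \sum_(w : k.-tuple bool) mass (s n) w * F w @[n --> \oo] -->
    M [::] * \sum_(w : k.-tuple bool) m w * F w.
  rewrite mulr_sumr; under [X in _ --> X]eq_bigr do rewrite mulrA -Mm.
  apply: cvg_big => [|w _]; first exact: add_continuous.
  by apply: cvgMr_tmp; exact: s_cvg.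
apply/cvgrPdist_lt => e e0.
have B0 : 0 <= B by apply: le_trans (cB 0%N); apply: sumr_ge0.
(* A third of e for each of: cutting the codes after k digits, the convergence of
   the masses of words of length k, the convergence in [tree_law]. *)
have e1 : 0 < e / 3 / (B + 1) by rewrite !divr_gt0// ltr_wpDl.
have [k0 k0P] := psi_unif _ e1.
have /cvgrPdist_lt/(_ (e / 3 / (M [::] + 1))) := LP _ cpsi.
have M1 : 0 < M [::] + 1 by rewrite ltr_wpDl.
case; first by rewrite !divr_gt0.
move=> k1 _ k1P.
pose k := maxn k0 k1.
have kP z1 z2 : agree k z1 z2 -> `|psi (phi z1) - psi (phi z2)| < e / 3 / (B + 1).
  by move=> zz; apply: k0P => i ik; apply: zz; rewrite leq_max ik.
have := k1P k (leq_maxr _ _); rewrite /= => kL.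
have /cvgrPdist_lt/(_ (e / 3)) := prefix_cvg k.
case; first by rewrite divr_gt0.
move=> n0 _ n0P; exists n0 => // n nn.
have := n0P n nn; have := discrete_prefix (s n) _ k kP; move: kL; rewrite /=.
have bnd b : 0 <= b -> b * (e / 3 / (b + 1)) <= e / 3.
  by move=> b0; rewrite mulrA ler_pdivrMr ?ltr_wpDl//; lra.
have Be := bnd _ B0; have Me := bnd _ (M0 [::]).
set I1 := \int[_]_(t in _) _; set L1 := \sum_(w : k.-tuple bool) m w * _.
set A1 := \sum_(i < _) _; set S1 := \sum_(w : k.-tuple bool) mass _ _ * _ => IL AS SL.
have {}IL : `|M [::] * I1 - M [::] * L1| <= e / 3.
  by rewrite -mulrBr normrM ger0_norm// (le_trans _ Me)// ler_wpM2l// ltW.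
move: (le_trans AS Be) IL SL; rewrite !ler_norml !ltr_norml.
by move=> /andP[? ?] /andP[? ?] /andP[? ?]; apply/andP; split; lra.
Qed.

(** * Almost everywhere convergence in convex classes *)

Section weighted_L2.
Context {R : realType} {d : measure_display} {T : measurableType d}.
Variables (mu : {measure set T -> \bar R}) (w : T -> R).
Hypothesis w0 : forall x, 0 <= w x.
Hypothesis iw : mu.-integrable setT (EFin \o w).

Lemma integrable_bounded_weight (k : T -> R) :
  measurable_fun setT k -> (forall x, `|k x| <= 1) ->
  mu.-integrable setT (EFin \o (fun x => k x * w x)).
Proof.
move=> mk k1; apply: le_integrable iw => //.
  apply/measurable_EFinP; apply: measurable_funM => //.
  by apply/measurable_EFinP; case/integrableP: iw.
move=> x _; rewrite lee_fin normrM ler_piMl//.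
Qed.

Definition wL2 (h : T -> R) : R := \int[mu]_x (h x ^+ 2 * w x).

(** L^2 bounds on the increments of g give L^1 bounds, since
    D <= c + D^2 / c for every c > 0; the choice c = 2^-n makes them summable, so
    the increments are summable almost everywhere where w > 0. The halves match
    the half differences in the parallelogram identity. *)
Lemma fast_cvg_ae (g : nat -> T -> R) :
  (forall n, decision_rule (g n)) ->
  (forall n, wL2 (fun x => (g n.+1 x - g n x) / 2) <= (4^-1) ^+ n) ->
  exists2 delta, decision_rule delta &
    {ae mu, forall x, 0 < w x -> g n x @[n --> \oo] --> delta x}.
Proof.
move=> ug g4.
have mg n : measurable_fun setT (g n) by case: (ug n).
have g01 n x : 0 <= g n x <= 1 by case: (ug n).
pose W := \int[mu]_x w x.
pose D n x := `|g n.+1 x - g n x| / 2.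
have mD n : measurable_fun setT (D n).
  apply: measurable_funM => //; apply: measurableT_comp => //.
  exact: measurable_funB.
have D0 n x : 0 <= D n x by rewrite divr_ge0.
have D1 n x : `|D n x| <= 1.
  rewrite ger0_norm//; have := g01 n x; have := g01 n.+1 x.
  rewrite /D => /andP[a b] /andP[a' b'].
  by rewrite ler_pdivrMr// mul1r ler_norml; lra.
have iD n := integrable_bounded_weight (mD n) (D1 n).
have DW n : \int[mu]_x (D n x * w x) <= (W + 1) * 2^-1 ^+ n.
  pose c : R := 2^-1 ^+ n.
  have c0 : 0 < c by rewrite exprn_gt0.
  have mD2 : measurable_fun setT (fun x => D n x ^+ 2) by exact: measurable_funX.
  have D21 x : `|D n x ^+ 2| <= 1 by rewrite normrX exprn_ile1.
  have iD2 := integrable_bounded_weight mD2 D21.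
  have E2 : \int[mu]_x (D n x ^+ 2 * w x) <= c ^+ 2.
    apply: le_trans (_ : (4^-1) ^+ n <= _); last first.
      by rewrite /c -exprM mulnC exprM expr2 -invfM -natrM.
    apply: le_trans (g4 n); rewrite /wL2 le_eqVlt; apply/orP; left; apply/eqP.
    apply: eq_Rintegral => x _.
    by rewrite /D !expr_div_n real_normK// num_real.
  have : \int[mu]_x (D n x * w x) <=
      \int[mu]_x (c * w x + c^-1 * (D n x ^+ 2 * w x)).
    apply: le_Rintegral => //.
      exact: (integrableD measurableT (integrableZl measurableT c iw)
        (integrableZl measurableT c^-1 iD2)).
    move=> x _; rewrite mulrA -mulrDl ler_wpM2r//.
    rewrite -subr_ge0 (_ : _ - _ = c^-1 * ((D n x - c) ^+ 2 + c * D n x)); last first.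
      by field; rewrite gt_eqF.
    apply: mulr_ge0; first by rewrite invr_ge0 ltW.
    by rewrite addr_ge0 ?sqr_ge0// mulr_ge0// ltW.
  move=> /le_trans; apply.
  rewrite RintegralD//; last 2 first.
    by have := integrableZl measurableT c iw.
    by have := integrableZl measurableT c^-1 iD2.
  rewrite !RintegralZl// mulrDl mul1r mulrC lerD//.
  by rewrite ler_pdivrMl// -expr2.
have sumfin : (\int[mu]_x (\sum_(n <oo) (D n x * w x)%:E) < +oo)%E.
  rewrite integral_nneseries//; last 2 first.
    by move=> n; case/integrableP: (iD n).
    by move=> n x _; rewrite lee_fin mulr_ge0.
  apply: (@le_lt_trans _ _ (\sum_(n <oo) ((W + 1) * 2^-1 ^+ n)%:E)%E).
    apply: lee_nneseries => [n _ _|n _].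
      by apply: integral_ge0 => x _; rewrite lee_fin mulr_ge0.
    rewrite -[leLHS]fineK ?lee_fin//; first exact: DW.
    by apply: integrable_fin_num => //; exact: iD.
  have W1 : 0 <= W + 1 by rewrite addr_ge0// Rintegral_ge0.
  have -> : (fun n => \sum_(0 <= k < n) ((W + 1) * 2^-1 ^+ k)%:E)%E =
      eseries (fun k => (2 * (W + 1) / (2 ^ (k + 1))%:R)%:E).
    apply/funext => n; apply: eq_bigr => k _; congr EFin.
    by rewrite addn1 expnS natrM natrX exprVn; field; rewrite expf_neq0.
  by rewrite (cvg_lim _ (@cvg_geometric_eseries_half R (2 * (W + 1)) 0))// ltry.
have mS : measurable_fun setT (fun x => \sum_(n <oo) (D n x * w x)%:E)%E.
  apply: (@emeasurable_fun_cvg _ _ _ _ (fun n x => \sum_(0 <= k < n) (D k x * w x)%:E)%E).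
    move=> m; apply: emeasurable_sum => n.
    exact: measurable_int (iD n).
  move=> x _; apply: (@is_cvg_nneseries _ (fun n => (D n x * w x)%:E) xpredT 0).
  by move=> n _ _; rewrite lee_fin mulr_ge0.
have Sfin : {ae mu, forall x, setT x -> ((\sum_(n <oo) (D n x * w x)%:E)%E \is a fin_num)}.
  apply: integrable_ae => //; apply/integrableP; split => //.
  under eq_integral => x _.
    rewrite gee0_abs; last first.
      by apply: nneseries_ge0 => n _ _; rewrite lee_fin mulr_ge0.
    over.
  by [].
(* The upper limit is measurable and is the limit wherever there is one. *)
exists (fun x => Num.min 1 (Num.max 0 (limn_sup (g ^~ x)))).
  split.
    apply: measurable_minr => //; apply: measurable_maxr => //.
    apply: measurable_fun_limn_sup => //.
      by move=> x _; exists 1 => _ [n _ <-]; case/andP: (g01 n x).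
      by move=> x _; exists 0 => _ [n _ <-]; case/andP: (g01 n x).
  by move=> x; rewrite le_min ler01/= le_max lexx/= ge_min lexx.
apply: filterS Sfin => x /(_ I) Sx wx.
have cg : cvgn (g ^~ x).
  have sDw : cvgn (series (fun n => D n x * w x)).
    apply: nnseries_is_cvg => [i|]; first by rewrite mulr_ge0.
    by rewrite -ge0_fin_numE// nneseries_ge0// => n _ _; rewrite lee_fin mulr_ge0.
  have sD : cvgn (series (telescope (g ^~ x))).
    apply: normed_cvg.
    have -> : [normed series (telescope (g ^~ x))] =
        series ((2 / w x) *: (fun n => D n x * w x)).
      apply/funext => n; rewrite /series/=; apply: eq_bigr => k _.
      rewrite /D/telescope/= {1}/GRing.scale/= {1}/GRing.scale/=.
      by field; rewrite gt_eqF.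
    exact: is_cvg_seriesZ.
  rewrite (_ : g ^~ x = (fun n => g 0 x + series (telescope (g ^~ x)) n)).
    by apply: is_cvgD => //; exact: is_cvg_cst.
  by apply/funext => n; rewrite -eq_sum_telescope.
have l01 : 0 <= limn (g ^~ x) <= 1.
  apply/andP; split.
    by apply: limr_ge => //; apply: nearW => n; case/andP: (g01 n x).
  by apply: limr_le => //; apply: nearW => n; case/andP: (g01 n x).
rewrite cvg_limn_supE// max_r ?min_r//; by case/andP: l01.
Qed.

Lemma wL2_parallelogram (h h' : T -> R) : decision_rule h -> decision_rule h' ->
  wL2 (fun x => (h x - h' x) / 2) + wL2 (fun x => (h x + h' x) / 2)
  = (wL2 h + wL2 h') / 2.
Proof.
move=> [mh h01] [mh' h01'].
have i2 (k : T -> R) : measurable_fun setT k -> (forall x, `|k x| <= 1) ->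
    mu.-integrable setT (EFin \o (fun x => k x ^+ 2 * w x)).
  move=> mk k1; apply: integrable_bounded_weight => //.
    exact: measurable_funX.
  by move=> x; rewrite normrX exprn_ile1.
have ih : mu.-integrable setT (EFin \o (fun x => h x ^+ 2 * w x)).
  by apply: i2 => // x; have := h01 x; rewrite ler_norml; lra.
have ih' : mu.-integrable setT (EFin \o (fun x => h' x ^+ 2 * w x)).
  by apply: i2 => // x; have := h01' x; rewrite ler_norml; lra.
rewrite /wL2 -RintegralD//; last 2 first.
- apply: i2 => [|x].
    by apply: measurable_funM => //; exact: measurable_funB.
  by have := h01 x; have := h01' x; rewrite ler_norml; lra.
- apply: i2 => [|x].
    by apply: measurable_funM => //; exact: measurable_funD.
  by have := h01 x; have := h01' x; rewrite ler_norml; lra.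
rewrite -RintegralD// -RintegralZr//; last exact: (integrableD measurableT ih ih').
by apply: eq_Rintegral => x _; field.
Qed.

(** This is what replaces a weak limit: in decreasing convex classes, the smallest
    values of the norm increase to a limit, and the parallelogram identity, with
    the midpoint of two near-minimisers in the same class, shows that the
    near-minimisers form a Cauchy sequence. A fast subsequence converges almost
    everywhere. *)
Lemma convex_classes_cvg_ae (C : nat -> set (T -> R)) :
  (forall n h, C n h -> decision_rule h) ->
  (forall n, C n.+1 `<=` C n) -> (forall n, C n !=set0) ->
  (forall n h h', C n h -> C n h' -> C n (fun x => (h x + h' x) / 2)) ->
  exists h : nat -> T -> R, (forall n, C n (h n)) /\
    exists2 delta, decision_rule delta &
      {ae mu, forall x, 0 < w x -> h n x @[n --> \oo] --> delta x}.
Proof.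
move=> uC dC C0 cC.
have le_C n m : (n <= m)%N -> C m `<=` C n.
  move=> /subnK <-; elim: (m - n)%N => [//|k IH] h.
  by rewrite addSn => /dC /IH.
pose E := wL2.
have E0 h : 0 <= E h.
  by apply: Rintegral_ge0 => x _; rewrite mulr_ge0// sqr_ge0.
pose W := \int[mu]_x w x.
have EW n h : C n h -> E h <= W.
  move=> /uC [mh h01]; apply: le_Rintegral => //.
    apply: integrable_bounded_weight => //; first exact: measurable_funX.
    move=> x; rewrite normrX exprn_ile1//.
    by have := h01 x; rewrite ler_norml; lra.
  move=> x _; rewrite ler_piMl// exprn_ile1//; by case/andP: (h01 x).
pose e n := inf [set E h | h in C n].
have has n : has_inf [set E h | h in C n].
  split; first by have [h Ch] := C0 n; exists (E h), h.
  by exists 0 => _ [h _ <-].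
have e_le n h : C n h -> e n <= E h.
  by move=> Ch; apply: ge_inf; [case: (has n)|exists h].
have e_ge n c : (forall h, C n h -> c <= E h) -> c <= e n.
  move=> H; apply: lb_le_inf; first by case: (has n).
  by move=> _ [h Ch <-]; exact: H.
have e_nd : nondecreasing_seq e.
  by move=> n m nm; apply: e_ge => h Ch; apply: e_le; exact: le_C Ch.
have e_ub n : e n <= W by have [h Ch] := C0 n; rewrite (le_trans (e_le _ _ Ch))// (EW n).
have e_cvg : e n @[n --> \oo] --> sup (range e).
  by apply: nondecreasing_cvgn => //; exists W => _ [n _ <-].
pose L := sup (range e).
have e_leL n : e n <= L.
  by apply: ub_le_sup; [exists W => _ [k _ <-]|exists n].
have near_min n : exists h, C n h /\ E h < e n + n.+1%:R^-1.
  have n0 : 0 < n.+1%:R^-1 :> R by rewrite invr_gt0.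
  have [_ [h Ch <-] hE] := inf_adherent n0 (has n).
  by exists h.
have [h hP] := choice near_min.
have Ch n : C n (h n) by case: (hP n).
(* Near-minimisers of rank at least N have norms below L + 1 / (N + 1), and their
   midpoint has norm at least e N. *)
pose eta N := L - e N + N.+1%:R^-1.
have close N n m : (N <= n)%N -> (N <= m)%N ->
    E (fun x => (h n x - h m x) / 2) <= eta N.
  move=> Nn Nm.
  have CN k : (N <= k)%N -> C N (h k) by move=> Nk; exact: le_C (Ch k).
  have := wL2_parallelogram (uC _ _ (Ch n)) (uC _ _ (Ch m)).
  have := e_le N _ (cC _ _ _ (CN _ Nn) (CN _ Nm)).
  have [_ En] := hP n; have [_ Em] := hP m.
  have := e_leL n; have := e_leL m.
  have inv k : (N <= k)%N -> k.+1%:R^-1 <= N.+1%:R^-1 :> R.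
    by move=> Nk; rewrite lef_pV2 ?posrE// ler_nat.
  have := inv _ Nn; have := inv _ Nm; rewrite /eta -!/(E _).
  move: En Em; rewrite -/E.
  move: (E _) (E _) (E _) (E _) n.+1%:R^-1 m.+1%:R^-1 N.+1%:R^-1 (e n) (e m) (e N) => *; lra.
have eta0 : eta n @[n --> \oo] --> (0 : R).
  rewrite -[0](addr0 0) -[X in X + _](subrr L).
  apply: cvgD; last exact: cvg_harmonic.
  by apply: cvgB => //; exact: cvg_cst.
have pickK j : exists K, forall N, (K <= N)%N -> eta N <= 4^-1 ^+ j.
  have j0 : 0 < 4^-1 ^+ j :> R by rewrite exprn_gt0.
  have [K _ HK] := (cvgr_le _ eta0) (4^-1 ^+ j) j0.
  by exists K => N KN; exact: HK.
have [K KP] := choice pickK.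
(* a nondecreasing sequence of ranks with K j <= k j and j <= k j *)
pose k j := (j + \sum_(i < j.+1) K i)%N.
have kS j : (k j <= k j.+1)%N.
  by rewrite /k [X in (_ <= _ + X)%N]big_ord_recr/= addSn leqW// leq_add2l leq_addr.
have kK j : (K j <= k j)%N by rewrite /k big_ord_recr/= addnA leq_addl.
have jk j : (j <= k j)%N by rewrite /k leq_addr.
have [delta udelta cdelta] := @fast_cvg_ae (fun j => h (k j))
  (fun j => uC _ _ (Ch (k j)))
  (fun j => le_trans (close (k j) _ _ (kS j) (leqnn _)) (KP j _ (kK j))).
exists (fun j => h (k j)); split => [j|]; first exact: le_C (Ch (k j)).
by exists delta.
Qed.

End weighted_L2.

(** * Calculus of the payoff and of the penalty *)

Section objective_calculus.
Context {R : realType}.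
Variable g : R -> R.
Hypothesis A2_differentiable : forall t : R, 0 < t < 1 -> derivable g t 1.
Hypothesis A2_derivative :
  forall t : R, 0 < t < 1 -> {for t, continuous g^`()%classic}.
Hypothesis A2_at0 : g t @[t --> 0^'+] --> g 0.
Hypothesis A2_at1 : g t @[t --> 1^'-] --> g 1.

Lemma g_within_continuous : {within `[0, 1], continuous g}.
Proof.
apply/continuous_within_itvP => //; split => // t; rewrite in_itv/= => t01.
by apply: differentiable_continuous; apply/derivable1_diffP; exact: A2_differentiable.
Qed.

Lemma g_increasing : (forall t : R, 0 < t < 1 -> 0 < g^`()%classic t) ->
  forall x y, 0 <= x -> x < y -> y <= 1 -> g x < g y.
Proof.
move=> A3 x y x0 xy y1.
apply: (@gtr0_derive1_lt_cc _ g 0 1) => //.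
- exact: g_within_continuous.
- by rewrite in_itv/=; lra.
- by rewrite in_itv/=; lra.
Qed.

Lemma g_cvg (q : nat -> R) (l : R) : (forall n, 0 <= q n <= 1) -> 0 <= l <= 1 ->
  q n @[n --> \oo] --> l -> g (q n) @[n --> \oo] --> g l.
Proof.
move=> q01 l01 ql.
have /subspace_continuousP/(_ l) := g_within_continuous.
rewrite /= in_itv/= => /(_ l01) gl.
apply: cvg_comp gl => U; rewrite /= /within/= => lU.
have [N _ NP] := ql _ lU; exists N => // n Nn /=; apply: (NP n Nn).
by rewrite /= in_itv/=; exact: q01.
Qed.

Lemma g_mean_value x y : 0 < x < 1 -> 0 < y < 1 ->
  exists2 c, Num.min x y <= c <= Num.max x y & g y - g x = g^`()%classic c * (y - x).
Proof.
have MV a b : 0 < a -> a <= b -> b < 1 ->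
    exists2 c, a <= c <= b & g b - g a = g^`()%classic c * (b - a).
  move=> a0 ab b1.
  have dg t : a <= t <= b -> derivable g t 1.
    by move=> tab; apply: A2_differentiable; lra.
  have [c cab ->] : exists2 c, c \in `[a, b]%R & g b - g a = g^`()%classic c * (b - a).
    apply: MVT_segment => //.
      move=> t; rewrite in_itv/= => tab.
      apply: DeriveDef; first by apply: dg; lra.
      by rewrite derive1E.
    by apply: derivable_within_continuous => t; rewrite in_itv/=; exact: dg.
  by exists c => //; rewrite in_itv/= in cab.
move=> /andP[x0 x1] /andP[y0 y1].
have [xy|/ltW yx] := leP x y; first exact: MV.
have [c cyx E] := MV y x y0 yx x1; exists c => //.
by rewrite -[LHS]opprB E -mulrN opprB.
Qed.

Lemma g_derivative_bounded a b : 0 < a -> b < 1 ->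
  exists M, forall t, a <= t <= b -> `|g^`()%classic t| <= M.
Proof.
move=> a0 b1; have [ab|ba] := leP a b; last by exists 0 => t; lra.
have cg : {within `[a, b], continuous (fun t => `|g^`()%classic t|)}.
  apply: continuous_in_subspaceT => t; rewrite inE/= in_itv/= => tab.
  apply: continuous_comp; last exact: norm_continuous.
  by apply: A2_derivative; lra.
have [c _ cP] := EVT_max ab cg.
by exists `|g^`()%classic c| => t tab; apply: cP; rewrite in_itv/=.
Qed.

(** The domination under which difference quotients of the payoff pass to the
    limit. *)
Lemma g_quotient_bounded a b M x y s : 0 < a -> b < 1 -> 0 < s ->
  (forall t, a <= t <= b -> `|g^`()%classic t| <= M) ->
  a <= x <= b -> a <= y <= b -> `|y - x| <= s -> `|(g y - g x) / s| <= M.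
Proof.
move=> a0 b1 s0 MP xab yab yx.
have [||c] := @g_mean_value x y; [lra|lra|].
rewrite ge_min le_max => cxy ->.
rewrite -mulrA normrM -[leRHS]mulr1 ler_pM//.
  by apply: MP; lra.
by rewrite normrM normfV (gtr0_norm s0) ler_pdivrMr// mul1r.
Qed.

(** The base point q n moves with the step, so differentiability at l would not
    do: the quotient is a value of the derivative between q n and the
    displaced point, and the continuity of the derivative at l concludes. *)
Lemma g_strict_derivative (q h s : nat -> R) (l k : R) : 0 < l < 1 ->
  q n @[n --> \oo] --> l -> h n @[n --> \oo] --> k ->
  s n @[n --> \oo] --> (0 : R) -> (forall n, 0 < s n) ->
  (g (q n + s n * h n) - g (q n)) / s n @[n --> \oo] --> g^`()%classic l * k.
Proof.
move=> l01 ql hk s0 s_gt0.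
pose r n := q n + s n * h n.
have rl : r n @[n --> \oo] --> l.
  rewrite -[l]addr0 -(mul0r k); apply: cvgD => //; exact: cvgM.
have near01 (u : nat -> R) : u n @[n --> \oo] --> l -> \forall n \near \oo, 0 < u n < 1.
  have : nbhs l [set t | t \in `]0, 1[%R] by apply: near_in_itvoo; rewrite in_itv.
  by move=> l01' /(_ _ l01')[N _ NP]; exists N => // n /NP; rewrite /= in_itv.
(* The mean value theorem applies only once both points are in ]0, 1[, which holds
   for large n; before that, c is 0. *)
have mv n : exists c, 0 < q n < 1 -> 0 < r n < 1 ->
    Num.min (q n) (r n) <= c <= Num.max (q n) (r n) /\
    g (r n) - g (q n) = g^`()%classic c * (r n - q n).
  have [q01|] := boolP (0 < q n < 1); last by exists 0.
  have [r01|] := boolP (0 < r n < 1); last by exists 0.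
  by have [c ? ?] := g_mean_value q01 r01; exists c.
have [c cP] := choice mv.
have cl : c n @[n --> \oo] --> l.
  apply/cvgrPdist_lt => e e0.
  have /cvgrPdist_lt/(_ e e0) lq := ql; have /cvgrPdist_lt/(_ e e0) lr := rl.
  apply: filterS2 (filterI lq lr) (filterI (near01 _ ql) (near01 _ rl)).
  move=> n [] + + [q01 r01]; have [+ _] := cP n q01 r01.
  by rewrite ge_min le_max !ltr_norml => *; apply/andP; split; lra.
have gc : g^`()%classic (c n) * h n @[n --> \oo] --> g^`()%classic l * k.
  apply: cvgM => //; apply: cvg_comp cl _; exact: A2_derivative.
apply: cvg_trans gc; apply: near_eq_cvg.
apply: filterS2 (near01 _ ql) (near01 _ rl) => n q01 r01.
have [_ ->] := cP n q01 r01.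
by rewrite /r addrAC subrr add0r; field; rewrite gt_eqF.
Qed.

End objective_calculus.

(** The squared positive part has derivative 2 max(a, 0) at a, and its first-order
    remainder u^2 does not depend on a: the penalty can be expanded at
    near-maximisers about which nothing is known. *)
Lemma pos_part_sqr_increment (R : realType) (a u : R) :
  Num.max (a + u) 0 ^+ 2 <= Num.max a 0 ^+ 2 + 2 * u * Num.max a 0 + u ^+ 2.
Proof. by have [] := leP a 0; have [] := leP (a + u) 0; nra. Qed.

Lemma near_maximizer (R : realType) (T : Type) (A : set T) (J : T -> R) (C e : R) :
  A !=set0 -> (forall x, A x -> J x <= C) -> 0 < e ->
  exists2 x, A x & forall x', A x' -> J x' <= J x + e.
Proof.
move=> [a Aa] JC e0.
have ubJ : has_ubound [set J x | x in A] by exists C => _ [x Ax <-]; exact: JC.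
have hs : has_sup [set J x | x in A] by split => //; exists (J a), a.
have [_ [x Ax <-] xe] := sup_adherent e0 hs.
exists x => // x' Ax'; rewrite -lerBlDr (le_trans _ (ltW xe))// lerB//.
by apply: ub_le_sup => //; exists x'.
Qed.

(** * Power functions *)

Section experiment.
Context {R : realType} {d1 : nat} {dY : measure_display}
  {Y : measurableType dY}.
Variables (mu : {measure set Y -> \bar R}) (f : 'rV[R]_d1 -> Y -> R).
Variable Theta : set 'rV[R]_d1.
Hypothesis Theta_compact : compact Theta.
Hypothesis f_density : forall theta, Theta theta -> is_density mu (f theta).
Hypothesis A1_continuity :
  forall (theta_ : nat -> 'rV[R]_d1) (theta : 'rV[R]_d1),
     (forall n, Theta (theta_ n)) -> Theta theta ->
     theta_ n @[n --> \oo] --> theta ->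
     (\int[mu]_y (`|f (theta_ n) y - f theta y|)%:E)%E @[n --> \oo] --> 0%E.
Hypothesis A1_equivalence : forall theta theta', Theta theta -> Theta theta' ->
     law mu f theta `<< law mu f theta' /\ law mu f theta' `<< law mu f theta.

Local Notation p := (power mu f).

Lemma density_integrable t : Theta t -> mu.-integrable setT (EFin \o f t).
Proof.
move=> /f_density [mf f0 f1]; apply/integrableP; split.
  exact/measurable_EFinP.
under eq_integral do rewrite /= ger0_norm//.
by rewrite f1 ltry.
Qed.

Lemma density_Rintegral1 t : Theta t -> \int[mu]_y f t y = 1.
Proof. by move=> /f_density [_ _]; rewrite /Rintegral => ->. Qed.

Lemma density_ge0 t y : Theta t -> 0 <= f t y.
Proof. by move=> /f_density [_ + _]; apply. Qed.

Lemma power_integrable t delta : Theta t -> decision_rule delta ->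
  mu.-integrable setT (EFin \o (fun y => delta y * f t y)).
Proof.
move=> tT [md d01]; apply: (integrable_bounded_weight (density_integrable tT)) => //.
by move=> y; have := d01 y; rewrite ler_norml; lra.
Qed.

Lemma power_ge0 t delta : Theta t -> decision_rule delta -> 0 <= p delta t.
Proof.
move=> tT [md d01]; apply: Rintegral_ge0 => y _.
by rewrite mulr_ge0 ?density_ge0//; case/andP: (d01 y).
Qed.

Lemma power_le1 t delta : Theta t -> decision_rule delta -> p delta t <= 1.
Proof.
move=> tT dd; rewrite -(density_Rintegral1 tT); apply: le_Rintegral => //.
- exact: power_integrable.
- exact: (density_integrable tT).
- move=> y _; rewrite ler_piMl ?density_ge0//.
  by case: dd => _ /(_ y) /andP[].
Qed.

Lemma power_cst t c : Theta t -> p (fun=> c) t = c.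
Proof.
move=> tT; rewrite /power RintegralZl//; last exact: (density_integrable tT).
by rewrite density_Rintegral1// mulr1.
Qed.

Lemma decision_rule_cst (c : R) : 0 <= c <= 1 -> decision_rule (fun _ : Y => c).
Proof. by move=> c01; split => //; exact: measurable_cst. Qed.

Lemma decision_rule_conv s (delta delta' : Y -> R) : 0 <= s <= 1 ->
  decision_rule delta -> decision_rule delta' ->
  decision_rule (fun y => delta y + s * (delta' y - delta y)).
Proof.
move=> /andP[s0 s1] [md d01] [md' d01']; split.
  apply: measurable_funD => //; apply: measurable_funM => //.
  exact: measurable_funB.
by move=> y; move: (d01 y) (d01' y); move: (delta y) (delta' y) => a b; nra.
Qed.

Lemma power_conv t s delta delta' : Theta t ->
  decision_rule delta -> decision_rule delta' ->
  p (fun y => delta y + s * (delta' y - delta y)) t =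
  p delta t + s * (p delta' t - p delta t).
Proof.
move=> tT dd dd'.
have i1 := power_integrable tT dd; have i2 := power_integrable tT dd'.
rewrite /power -RintegralB// -RintegralZl//; last exact: (integrableB measurableT i2 i1).
rewrite -RintegralD//; last first.
  exact: (integrableZl measurableT s (integrableB measurableT i2 i1)).
by apply: eq_Rintegral => y _; ring.
Qed.

Lemma decision_rule_compl (delta : Y -> R) :
  decision_rule delta -> decision_rule (fun y => 1 - delta y).
Proof.
move=> [md d01]; split; first exact: measurable_funB.
by move=> y; have := d01 y; lra.
Qed.

Lemma power_compl t delta : Theta t -> decision_rule delta ->
  p (fun y => 1 - delta y) t = 1 - p delta t.
Proof.
move=> tT dd; rewrite -[X in X - _](density_Rintegral1 tT) /power -RintegralB//.
- by apply: eq_Rintegral => y _; ring.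
- exact: (density_integrable tT).
- exact: power_integrable.
Qed.

Definition L1_dist t t' : R := \int[mu]_y `|f t y - f t' y|.

Lemma L1_dist_integrable t t' : Theta t -> Theta t' ->
  mu.-integrable setT (EFin \o (fun y => `|f t y - f t' y|)).
Proof.
move=> tT tT'; apply: integrable_norm.
exact: (integrableB measurableT (density_integrable tT) (density_integrable tT')).
Qed.

Lemma L1_distC t t' : L1_dist t t' = L1_dist t' t.
Proof. by apply: eq_Rintegral => y _; rewrite distrC. Qed.

Lemma L1_dist_triangle t t' t'' : Theta t -> Theta t' -> Theta t'' ->
  L1_dist t t'' <= L1_dist t t' + L1_dist t' t''.
Proof.
move=> T1 T2 T3; rewrite /L1_dist -RintegralD//; try exact: L1_dist_integrable.
apply: le_Rintegral => //; first exact: L1_dist_integrable.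
  exact: (integrableD measurableT (L1_dist_integrable T1 T2) (L1_dist_integrable T2 T3)).
by move=> y _; exact: ler_distD.
Qed.

(** The bound does not depend on the rule: the powers of all rules are
    equicontinuous. *)
Lemma power_lipschitz delta t t' : decision_rule delta -> Theta t -> Theta t' ->
  `|p delta t - p delta t'| <= L1_dist t t'.
Proof.
move=> dd T1 T2; rewrite /power -RintegralB//; try exact: power_integrable.
have ii := integrableB measurableT (power_integrable T1 dd) (power_integrable T2 dd).
apply: (le_trans (le_normr_Rintegral _ ii)) => //.
apply: le_Rintegral => //.
- exact: (integrable_norm ii).
- exact: L1_dist_integrable.
- move=> y _ /=; rewrite -mulrBr normrM ler_piMl//.
  by case: dd => _ /(_ y); rewrite ler_norml; lra.
Qed.

(** The sequential continuity of the densities in the parameter, as a statement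
    about neighbourhoods. *)
Lemma L1_dist_near t e : Theta t -> 0 < e ->
  \forall t' \near t, Theta t' -> L1_dist t' t < e.
Proof.
move=> tT e0; apply: contrapT => H.
have {}H n : exists t', ball t n.+1%:R^-1 t' /\ Theta t' /\ e <= L1_dist t' t.
  apply: contrapT => /forallNP K; apply: H.
  apply/nbhs_ballP; exists n.+1%:R^-1 => /=; first by rewrite invr_gt0.
  move=> t' bt' Tt'; rewrite ltNge; apply/negP => et.
  by apply: (K t').
have [s sP] := choice H.
have st : s n @[n --> \oo] --> t.
  apply/cvg_ballP => r r0; near=> n.
  have [bs _] := sP n; apply: le_ball bs.
  by apply: ltW; near: n; exact: near_infty_natSinv_lt (PosNum r0).
have := A1_continuity (fun n => (sP n).2.1) tT st.
move=> /fine_cvgP[_ /cvgr_lt /(_ e e0)] [N _ NP].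
by have := NP N (leqnn N); have [_ [_]] := sP N; rewrite /L1_dist /Rintegral/= leNgt => /negP.
Unshelve. all: end_near. Qed.

Lemma power_continuous delta : decision_rule delta ->
  {within Theta, continuous (p delta)}.
Proof.
move=> dd; apply/subspace_continuousP => t tT; apply/cvgrPdist_lt => e e0.
rewrite near_withinE; apply: filterS (L1_dist_near tT e0) => t' H Tt'.
by apply: le_lt_trans (power_lipschitz dd tT Tt') _; rewrite L1_distC H.
Qed.

(** Mutual absolute continuity, read on the densities: where one of them vanishes,
    so do the others almost everywhere. Statements that are known where f t > 0
    thus carry over to every other parameter. *)
Lemma density_null_transfer t t' (A : set Y) : Theta t -> Theta t' ->
  measurable A -> {ae mu, forall y, A y -> f t y = 0} ->
  {ae mu, forall y, A y -> f t' y = 0}.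
Proof.
move=> tT tT' mA ft0.
have lawE s B : Theta s -> law mu f s B = (\int[mu]_(y in B) `|(EFin \o f s) y|)%E.
  by move=> sT; apply: eq_integral => y _; rewrite /= ger0_norm// density_ge0.
have mfs s : Theta s -> measurable_fun A (EFin \o f s).
  by move=> /f_density [mf _ _]; apply/measurable_EFinP; exact: measurable_funS mf.
have nA : (law mu f t).-null_set A.
  move=> B mB BA; rewrite lawE//.
  have mfB : measurable_fun B (EFin \o f t).
    by apply: measurable_funS (mfs _ tT).
  apply/(ae_eq_integral_abs mu mB mfB).
  by apply: filterS ft0 => y H By; congr EFin; apply: H; exact: BA.
have [_ ac] := A1_equivalence tT tT'.
have := ac _ nA A mA (@subset_refl _ A); rewrite lawE//.
move=> /(ae_eq_integral_abs mu mA (mfs _ tT')).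
by apply: filterS => y H /H [].
Qed.

(** Convergence where one density is positive suffices for all parameters, as the
    other densities vanish almost everywhere else. *)
Lemma power_cvg t0 (h : nat -> Y -> R) delta : Theta t0 ->
  (forall n, decision_rule (h n)) -> decision_rule delta ->
  {ae mu, forall y, 0 < f t0 y -> h n y @[n --> \oo] --> delta y} ->
  forall t, Theta t -> p (h n) t @[n --> \oo] --> p delta t.
Proof.
move=> T0 dh dd hd t tT.
have mf s : Theta s -> measurable_fun setT (f s) by move=> /f_density[].
have mA : measurable [set y | f t0 y = 0].
  have -> : [set y | f t0 y = 0] = setT `&` f t0 @^-1` [set 0] by rewrite setTI.
  exact: mf.
have H := density_null_transfer T0 tT mA (aeW _ (fun _ => id)).
apply: (@Rintegral_cvg _ _ _ mu setT (fun n y => h n y * f t y) _ (f t)) => //.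
- by move=> n; apply: measurable_funM; [case: (dh n)|exact: mf].
- by apply: measurable_funM; [case: dd|exact: mf].
- exact: (density_integrable tT).
- apply: filterS2 hd H => y hy fy _.
  have [/eqP f0|f0] := boolP (f t0 y == 0).
    by rewrite fy//; under eq_fun do rewrite mulr0; rewrite mulr0; exact: cvg_cst.
  apply: cvgMr_tmp; apply: hy.
  by rewrite lt_neqAle eq_sym f0 density_ge0.
- move=> n y _; rewrite normrM (ger0_norm (density_ge0 _ _))// ler_piMl ?density_ge0//.
  by case: (dh n) => _ /(_ y); rewrite ler_norml; lra.
Qed.

(** If p(t; delta) = 0, then f t vanishes almost everywhere where delta does not,
    and so does f t'. Applied to an optimal rule and to its complement, this keeps
    the power away from 0 and 1. *)
Lemma power_eq0 t t' delta : Theta t -> Theta t' -> decision_rule delta ->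
  p delta t = 0 -> p delta t' = 0.
Proof.
move=> tT tT' dd pt0.
have [md d01] := dd.
have d0 y : 0 <= delta y by case/andP: (d01 y).
have mA : measurable [set y | delta y != 0].
  have -> : [set y | delta y != 0] = ~` (setT `&` delta @^-1` [set 0]).
    by rewrite setTI; apply/seteqP; split => y /= /eqP.
  by apply: measurableC; exact: md.
have mdf s : Theta s -> measurable_fun setT (EFin \o (fun y => delta y * f s y)).
  by move=> sT; exact: (measurable_int mu (power_integrable sT dd)).
have aet : {ae mu, forall y, [set y | delta y != 0] y -> f t y = 0}.
  have : (\int[mu]_y `|(EFin \o (fun y => delta y * f t y)%R) y| = 0)%E.
    under eq_integral do rewrite /= ger0_norm ?mulr_ge0// ?density_ge0//.
    rewrite -[LHS]fineK; first by rewrite [X in X%:E]pt0.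
    by apply: integrable_fin_num => //; exact: power_integrable.
  move=> /(ae_eq_integral_abs mu measurableT (mdf _ tT)).
  by apply: filterS => y /(_ I) /= [] /eqP; rewrite mulf_eq0 => /orP[/eqP ->|/eqP]//; rewrite eqxx.
have H := density_null_transfer tT tT' mA aet.
rewrite /power /Rintegral.
rewrite (@ae_eq_integral _ _ _ mu setT (cst 0%E))//.
- by rewrite integral_cst// mul0e.
- exact: mdf.
- apply: filterS H => y H _ /=; congr EFin.
  have [->|/H ->] := eqVneq (delta y) 0; by rewrite ?mul0r ?mulr0.
Qed.

(** This stands for the weak-* compactness of the set of rules. The points coded by
    finite words are dense in Theta; along a subsequence the powers converge there,
    to l. The class C n of rules with powers within 1 / (n + 1) of l at the first n
    points is convex, decreasing in n and contains some delta_ (s m), so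
    [convex_classes_cvg_ae] yields a rule whose power is l at every dense point.
    Equicontinuity makes the convergence uniform on Theta. *)
Lemma power_sequentially_compact (delta_ : nat -> Y -> R) :
  Theta !=set0 -> (forall n, decision_rule (delta_ n)) ->
  exists (s : nat -> nat) (delta : Y -> R),
    [/\ forall n, (n <= s n)%N, decision_rule delta &
      forall e, 0 < e -> \forall n \near \oo,
        forall t, Theta t -> `|p (delta_ (s n)) t - p delta t| < e].
Proof.
move=> Theta_neq0 dd_.
have [phi [phiT phi_surj phi_cont]] := cantor_param Theta_compact Theta_neq0.
have phi_unif e : 0 < e -> exists k, forall z z', agree k z z' ->
    L1_dist (phi z) (phi z') < e.
  move: e; apply: cantor_uniform => [z z'|x y z|z e e0].
  - exact: L1_distC.
  - exact: L1_dist_triangle.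
  - have [k kP] := phi_cont z _ (L1_dist_near (phiT z) e0).
    by exists k => z' /kP H; rewrite L1_distC; exact: H.
pose pt (w : seq bool) := phi (nth false w).
have ptT w : Theta (pt w) by exact: phiT.
have p_le1 n w : `|p (delta_ n) (pt w)| <= 1.
  by rewrite ger0_norm ?power_ge0// power_le1.
have [s [l [s_ge s_cvg]]] := bounded_subsequence p_le1.
pose C n : set (Y -> R) := [set h | decision_rule h /\
  forall w, (pickle w < n)%N -> `|l w - p h (pt w)| <= n.+1%:R^-1].
have [h [Ch [delta ddelta hdelta]]] : exists h : nat -> Y -> R,
    (forall n, C n (h n)) /\ exists2 delta, decision_rule delta &
      {ae mu, forall y, 0 < f (pt [::]) y -> h n y @[n --> \oo] --> delta y}.
  apply: convex_classes_cvg_ae.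
  - by move=> y; exact: density_ge0.
  - exact: density_integrable.
  - by move=> n g [].
  - move=> n g [dg Hg]; split => // w wn.
    rewrite (le_trans (Hg w (ltnW wn)))// lef_pV2 ?posrE// ler_nat.
    by rewrite ltnS ltnW.
  - move=> n.
    have [] : \forall m \near \oo, forall w : seq bool, (pickle w < n)%N ->
        `|l w - p (delta_ (s m)) (pt w)| <= n.+1%:R^-1.
      apply: (@near_initial_segment _ _ \oo
        (fun w m => `|l w - p (delta_ (s m)) (pt w)| <= n.+1%:R^-1)) => w.
      have /cvgrPdist_le := s_cvg w; apply.
      by rewrite invr_gt0.
    by move=> N _ /(_ N (leqnn N)) HN; exists (delta_ (s N)).
  - move=> n g g' [dg Hg] [dg' Hg'].
    have gE : (fun y => (g y + g' y) / 2) = (fun y => g y + 2^-1 * (g' y - g y)).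
      by apply/funext => y; field.
    have half01 : 0 <= (2^-1 : R) <= 1 by rewrite invr_ge0 ler0n invf_le1// ler1n.
    rewrite gE; split => [|w wn]; first exact: decision_rule_conv.
    rewrite power_conv//.
    move: (Hg w wn) (Hg' w wn); rewrite !ler_norml.
    move: (p g _) (p g' _) (l w) (n.+1%:R^-1 : R) => a b c e.
    by move=> /andP[? ?] /andP[? ?]; apply/andP; split; lra.
have dh n : decision_rule (h n) by case: (Ch n).
have p_cvg := power_cvg (ptT [::]) dh ddelta hdelta.
have pl w : p delta (pt w) = l w.
  apply: (@cvg_unique _ _ (fmap (fun n => p (h n) (pt w)) \oo)) => //.
    exact: p_cvg.
  apply/cvgrPdist_le => e e0; near=> n.
  have [_ /(_ w) H] := Ch n; rewrite (le_trans (H _))//.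
    by near: n; exact: nbhs_infty_gt.
  by apply: ltW; near: n; exact: near_infty_natSinv_lt (PosNum e0).
exists s, delta; split => // e e0.
have e30 : 0 < e / 3 by rewrite divr_gt0.
have [k kP] := phi_unif _ e30.
have near_words : \forall n \near \oo, forall w : k.-tuple bool,
    `|l w - p (delta_ (s n)) (pt w)| < e / 3.
  apply: filter_forall => w; have /cvgrPdist_lt := s_cvg w; exact.
apply: filterS near_words => n Hn _ /phi_surj[z <-].
pose w := [tuple of mkseq z k].
have zw : agree k z (nth false w) by move=> i ik; rewrite nth_mkseq.
have zlt := kP _ _ zw.
have l1 := le_lt_trans (power_lipschitz (dd_ (s n)) (phiT z) (ptT w)) zlt.
have l2 := le_lt_trans (power_lipschitz ddelta (phiT z) (ptT w)) zlt.
have := Hn w; rewrite -pl.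
move: l1 l2; move: (p _ _) (p _ _) (p _ _) (p _ _) => a b c d.
by rewrite !ltr_norml => /andP[? ?] /andP[? ?] /andP[? ?]; apply/andP; split; lra.
Unshelve. all: end_near. Qed.

(** * The objective *)

Variables (Theta0 Theta1 : set 'rV[R]_d1)
  (Lambda1 : probability (borel_rV R d1) R) (alpha : R) (g : R -> R).
Hypothesis Theta0_sub : Theta0 `<=` Theta.
Hypothesis Theta0_compact : compact Theta0.
Hypothesis Theta0_neq0 : Theta0 !=set0.
Hypothesis Theta1_sub : Theta1 `<=` Theta.
Hypothesis mTheta1 : measurable (Theta1 : set (borel_rV R d1)).
Hypothesis Lambda1_on : Lambda1 Theta1 = 1%E.
Hypothesis alpha_gt0 : 0 < alpha.
Hypothesis alpha_lt1 : alpha < 1.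
Hypothesis g_measurable : measurable_fun (`[0, 1] : set R) g.
Hypothesis A2_differentiable : forall t : R, 0 < t < 1 -> derivable g t 1.
Hypothesis A2_derivative :
  forall t : R, 0 < t < 1 -> {for t, continuous g^`()%classic}.
Hypothesis A2_at0 : g t @[t --> 0^'+] --> g 0.
Hypothesis A2_at1 : g t @[t --> 1^'-] --> g 1.
Hypothesis A3 : forall t : R, 0 < t < 1 -> 0 < g^`()%classic t.

Local Notation G := (objective mu f Theta1 Lambda1 g).

Lemma power_measurable (A : set 'rV[R]_d1) delta :
  A `<=` Theta -> measurable (A : set (borel_rV R d1)) ->
  decision_rule delta ->
  measurable_fun (A : set (borel_rV R d1)) (p delta).
Proof.
move=> AT mA dd; have cT := compact_closed_rV Theta_compact.
apply: (measurable_funS (borel_rV_closed cT) AT).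
by apply: within_continuous_borel => //; exact: power_continuous.
Qed.

Lemma power01 t delta : Theta t -> decision_rule delta -> 0 <= p delta t <= 1.
Proof. by move=> tT dd; rewrite power_ge0// power_le1. Qed.

Lemma g_nondecreasing x y : 0 <= x -> x <= y -> y <= 1 -> g x <= g y.
Proof.
move=> x0; rewrite le_eqVlt => /predU1P[-> //|xy y1]; apply: ltW.
exact: (g_increasing A2_differentiable A2_at0 A2_at1 A3).
Qed.

Lemma payoff_measurable delta : decision_rule delta ->
  measurable_fun (Theta1 : set (borel_rV R d1)) (fun t => g (p delta t)).
Proof.
move=> dd; apply: (measurable_comp _ _ g_measurable (power_measurable Theta1_sub mTheta1 dd)) => //.
by move=> _ [t tT <-]; rewrite /= in_itv/=; apply: power01 => //; exact: Theta1_sub.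
Qed.

Lemma payoff_bounds t delta : Theta1 t -> decision_rule delta ->
  g 0 <= g (p delta t) <= g 1.
Proof.
move=> /Theta1_sub tT dd; have /andP[p0 p1] := power01 tT dd.
by rewrite !g_nondecreasing.
Qed.

Lemma payoff_integrable delta : decision_rule delta ->
  Lambda1.-integrable Theta1 (EFin \o (fun t => g (p delta t))).
Proof.
move=> dd; apply: (integrable_bounded_probability Lambda1 (M := `|g 0| + `|g 1|) mTheta1).
  exact: payoff_measurable.
move=> t tT; have := payoff_bounds tT dd.
have := ler_norm (g 1); have := ler_norm (- g 0); rewrite normrN ler_norml.
have := normr_ge0 (g 1); have := normr_ge0 (g 0).
by move=> *; apply/andP; split; lra.
Qed.

Lemma objective_bounds delta : decision_rule delta -> g 0 <= G delta <= g 1.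
Proof.
move=> dd; have icst (c : R) : Lambda1.-integrable Theta1 (EFin \o cst c).
  exact: finite_measure_integrable_cst.
apply/andP; split.
  rewrite -[leLHS](Rintegral_cst_probability mTheta1 Lambda1_on); apply: le_Rintegral => //.
    exact: icst.
    exact: payoff_integrable.
  by move=> t tT; case/andP: (payoff_bounds tT dd).
rewrite -[leRHS](Rintegral_cst_probability mTheta1 Lambda1_on); apply: le_Rintegral => //.
  exact: payoff_integrable.
  exact: icst.
by move=> t tT; case/andP: (payoff_bounds tT dd).
Qed.

Lemma eq_objective delta (c : R) : (forall t, Theta t -> p delta t = c) ->
  G delta = g c.
Proof.
move=> pc; rewrite -[RHS](Rintegral_cst_probability mTheta1 Lambda1_on); apply: eq_Rintegral => t.
by rewrite inE => /Theta1_sub/pc ->.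
Qed.

Lemma objective_cvg (delta_ : nat -> Y -> R) delta :
  (forall n, decision_rule (delta_ n)) -> decision_rule delta ->
  (forall t, Theta t -> p (delta_ n) t @[n --> \oo] --> p delta t) ->
  G (delta_ n) @[n --> \oo] --> G delta.
Proof.
move=> dd_ dd pd.
apply: (@Rintegral_cvg _ _ _ Lambda1 Theta1 _ _ (fun=> `|g 0| + `|g 1|)) => //.
- by move=> n; exact: payoff_measurable.
- exact: payoff_measurable.
- exact: finite_measure_integrable_cst.
- apply: aeW => t /Theta1_sub tT; apply: (g_cvg A2_differentiable A2_at0 A2_at1).
  + by move=> n; exact: power01.
  + exact: power01.
  + exact: pd.
- move=> n t tT; have := payoff_bounds tT (dd_ n).
  have := ler_norm (g 1); have := ler_norm (- g 0); rewrite normrN ler_norml.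
  have := normr_ge0 (g 1); have := normr_ge0 (g 0).
  by move=> *; apply/andP; split; lra.
Qed.

(** * Penalised maximisers and their multipliers *)

Section penalization.
Variable x : nat -> 'rV[R]_d1.
Hypothesis xT : forall i, Theta0 (x i).

Definition excess (delta : Y -> R) (i : nat) := Num.max (p delta (x i) - alpha) 0.

(** With n constraints of weight n, the quadratic remainders of the penalty amount
    to n^2 / 2 times the step once divided by it; the cube makes that O(1 / n). *)
Definition step_size (n : nat) : R := n.+1%:R^-1 ^+ 3.

Definition penalized (n : nat) (delta : Y -> R) : R :=
  G delta - n%:R / 2 * \sum_(i < n) excess delta i ^+ 2.

(** The slope inequality is the first-order condition at a near-maximiser, whose
    multipliers are the derivatives of the penalty. The maximum is missed by at
    most step_size n / (n + 1), which remains small after division by the step. *)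
Lemma penalized_sequence : exists delta_ : nat -> Y -> R,
  [/\ forall n, decision_rule (delta_ n),
   forall n delta, decision_rule delta ->
     penalized n delta <= penalized n (delta_ n) + n.+1%:R^-1 &
   forall n delta, decision_rule delta ->
     (G (fun y => delta_ n y + step_size n * (delta y - delta_ n y)) - G (delta_ n))
       / step_size n <=
     \sum_(i < n) n%:R * excess (delta_ n) i * (p delta (x i) - p (delta_ n) (x i))
     + 2 / n.+1%:R].
Proof.
have s0 n : 0 < step_size n by rewrite exprn_gt0.
have s1 n : step_size n <= 1 by rewrite exprn_ile1// invf_le1// ler1n.
have pick n : exists2 delta, decision_rule delta & forall delta', decision_rule delta' ->
    penalized n delta' <= penalized n delta + step_size n / n.+1%:R.
  apply: (@near_maximizer _ _ decision_rule (penalized n) (g 1)).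
  - exists (fun=> 0); apply: decision_rule_cst.
    by rewrite lexx ler01.
  - move=> delta dd; rewrite /penalized lerBlDr.
    rewrite (le_trans (proj2 (andP (objective_bounds dd))))// lerDl mulr_ge0//.
    by apply: sumr_ge0 => i _; exact: sqr_ge0.
  - by rewrite divr_gt0.
have [delta_ dP] := choice (fun n => let: ex_intro2 d a b := pick n in ex_intro _ d (conj a b)).
have dd_ n : decision_rule (delta_ n) by case: (dP n).
exists delta_; split => // n delta dd.
  have [_ /(_ _ dd)] := dP n => /le_trans; apply.
  by rewrite lerD2l ler_piMl// invr_ge0.
set s := step_size n; have ss : 0 < s by exact: s0.
have s01 : 0 <= s <= 1 by rewrite (ltW ss) s1.
pose h i := p delta (x i) - p (delta_ n) (x i).
have h1 i : h i ^+ 2 <= 1.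
  have := power_ge0 (Theta0_sub (xT i)) dd; have := power_le1 (Theta0_sub (xT i)) dd.
  have := power_ge0 (Theta0_sub (xT i)) (dd_ n); have := power_le1 (Theta0_sub (xT i)) (dd_ n).
  by rewrite /h; nra.
have [_ /(_ _ (decision_rule_conv s01 (dd_ n) dd))] := dP n.
set delta' := (fun y => _); rewrite /penalized => JJ.
have E i : excess delta' i ^+ 2 - excess (delta_ n) i ^+ 2 <=
    2 * (s * h i) * excess (delta_ n) i + s ^+ 2.
  rewrite lerBlDl addrA /excess power_conv//; last exact: Theta0_sub.
  rewrite (_ : _ + _ - alpha = (p (delta_ n) (x i) - alpha) + s * h i); last by rewrite addrAC.
  apply: (le_trans (pos_part_sqr_increment _ _)); rewrite lerD2l exprMn.
  by rewrite ler_piMr ?sqr_ge0.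
have {E} SE : \sum_(i < n) excess delta' i ^+ 2 - \sum_(i < n) excess (delta_ n) i ^+ 2 <=
    2 * s * \sum_(i < n) excess (delta_ n) i * h i + n%:R * s ^+ 2.
  rewrite -sumrB mulr_sumr.
  have -> : n%:R * s ^+ 2 = \sum_(i < n) s ^+ 2 by rewrite sumr_const card_ord mulr_natl.
  rewrite -big_split/=; apply: ler_sum => i _; apply: (le_trans (E i)).
  by rewrite le_eqVlt; apply/orP; left; apply/eqP; ring.
rewrite ler_pdivrMr//.
have -> : \sum_(i < n) n%:R * excess (delta_ n) i * (p delta (x i) - p (delta_ n) (x i))
    = n%:R * \sum_(i < n) excess (delta_ n) i * h i.
  by rewrite mulr_sumr; apply: eq_bigr => i _; rewrite mulrA.
have n0 : 0 <= n%:R / 2 :> R by rewrite divr_ge0.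
have := ler_wpM2l n0 SE.
have small : n%:R ^+ 2 * s <= n.+1%:R^-1.
  have -> : n%:R ^+ 2 * s = n.+1%:R^-1 * (n%:R / n.+1%:R) ^+ 2.
    by rewrite /s /step_size; move: (n.+1%:R^-1) => i; ring.
  rewrite ler_piMr ?invr_ge0// exprn_ile1//.
  by rewrite ler_pdivrMr// mul1r ler_nat.
have := ler_wpM2r (ltW ss) small.
move: JJ; rewrite -/s; set e := n.+1%:R^-1.
move: (G _) (G _) (\sum_(i < n) excess _ _ ^+ 2) (\sum_(i < n) excess _ _ ^+ 2).
move: (\sum_(i < n) _) => S a b c d.
have -> : s / n.+1%:R = e * s by rewrite mulrC.
have es0 : 0 <= e * s by rewrite mulr_ge0 ?invr_ge0// ltW.
move: es0; move: (n%:R : R) e => N e; lra.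
Qed.

Hypothesis x_dense : forall t U, Theta0 t -> nbhs t U -> exists i, U (x i).
Variable delta_ : nat -> Y -> R.
Hypothesis dd_ : forall n, decision_rule (delta_ n).
Hypothesis penalty_ge : forall n delta, decision_rule delta ->
  penalized n delta <= penalized n (delta_ n) + n.+1%:R^-1.
Hypothesis slope_le : forall n delta, decision_rule delta ->
  (G (fun y => delta_ n y + step_size n * (delta y - delta_ n y)) - G (delta_ n))
    / step_size n <=
  \sum_(i < n) n%:R * excess (delta_ n) i * (p delta (x i) - p (delta_ n) (x i))
  + 2 / n.+1%:R.
Variables (s : nat -> nat) (delta : Y -> R).
Hypothesis s_ge : forall n, (n <= s n)%N.
Hypothesis dd : decision_rule delta.
Hypothesis p_unif : forall e, 0 < e -> \forall n \near \oo,
  forall t, Theta t -> `|p (delta_ (s n)) t - p delta t| < e.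

Lemma limit_power_cvg t : Theta t -> p (delta_ (s n)) t @[n --> \oo] --> p delta t.
Proof.
move=> tT; apply/cvgrPdist_lt => e e0.
by apply: filterS (p_unif e0) => n /(_ t tT); rewrite distrC.
Qed.

Lemma inv_s_cvg0 (k : R) : k / (s n).+1%:R @[n --> \oo] --> (0 : R).
Proof.
rewrite -[0](mulr0 k); apply: cvgMl_tmp.
apply: (@squeeze_cvgr _ _ _ _ (fun=> 0) (fun n => n.+1%:R^-1)).
- apply: nearW => n; rewrite invr_ge0 ler0n/= lef_pV2 ?posrE// ler_nat ltnS.
  exact: s_ge.
- exact: cvg_cst.
- exact: cvg_harmonic.
Qed.

Lemma excess_feasible d i : p d (x i) <= alpha -> excess d i = 0.
Proof. by move=> pa; rewrite /excess max_r// subr_le0. Qed.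

(** A feasible rule pays no penalty, so it cannot beat delta_ n by more than
    1 / (n + 1). *)
Lemma limit_optimal d : decision_rule d -> (forall t, Theta0 t -> p d t <= alpha) ->
  G d <= G delta.
Proof.
move=> ddd fd.
have GG : G (delta_ (s n)) + 1 / (s n).+1%:R @[n --> \oo] --> G delta.
  rewrite -[G delta]addr0; apply: cvgD; last exact: inv_s_cvg0.
  apply: objective_cvg => // t.
  exact: limit_power_cvg.
rewrite -(cvg_lim _ GG)//; apply: limr_ge; first by apply/cvg_ex; exists (G delta).
apply: nearW => n; have := penalty_ge (s n) ddd; rewrite /penalized.
rewrite big1 => [|i _]; last by rewrite excess_feasible ?expr0n// fd.
rewrite mulr0 subr0 div1r => /le_trans; apply; rewrite lerD2r gerBl.
by rewrite mulr_ge0 ?divr_ge0// sumr_ge0// => i _; rewrite sqr_ge0.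
Qed.

(** An excess of 2e at some x i would cost delta_ n a penalty of at least n e^2 / 2,
    eventually more than the whole range of the objective. Density of the points
    and continuity of the power extend the bound to Theta0. *)
Lemma limit_feasible t : Theta0 t -> p delta t <= alpha.
Proof.
have feasible_x i : p delta (x i) <= alpha.
  rewrite leNgt; apply/negP => pa.
  pose e := (p delta (x i) - alpha) / 2.
  have e0 : 0 < e by rewrite divr_gt0// subr_gt0.
  pose C := g 1 - g 0 + 1.
  have [N _ NP] : \forall n \near \oo, C < n%:R / 2 * e ^+ 2.
    have e2 : 0 < e ^+ 2 / 2 by rewrite divr_gt0// exprn_gt0.
    near=> n; rewrite mulrAC -mulrA -ltr_pdivrMr//.
    by near: n; exact: nbhs_infty_gtr.
  have [N' _ NP'] := p_unif e0.
  pose n := maxn N (maxn N' i.+1).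
  have [nN [nN' ni]] : (N <= n)%N /\ (N' <= n)%N /\ (i < n)%N.
    by rewrite /n !leq_max !leqnn !orbT.
  have := NP' n nN' (x i) (Theta0_sub (xT i)) => /= pe.
  have := NP (s n) (leq_trans nN (s_ge n)) => /= CP.
  have is_ : (i < s n)%N by exact: leq_trans (s_ge n).
  have d0 : decision_rule (fun _ : Y => 0 : R).
    by apply: decision_rule_cst; rewrite lexx ler01.
  have := penalty_ge (s n) d0; rewrite /penalized.
  rewrite [X in G _ - _ * X <= _]big1 => [|j _]; last first.
    rewrite excess_feasible ?expr0n// power_cst ?ltW//.
    exact: Theta0_sub.
  rewrite mulr0 subr0 (bigD1 (Ordinal is_))//= => H.
  have r0 : 0 <= \sum_(j < s n | j != Ordinal is_) excess (delta_ (s n)) j ^+ 2.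
    by apply: sumr_ge0 => j _; exact: sqr_ge0.
  have ex : e ^+ 2 <= excess (delta_ (s n)) i ^+ 2.
    rewrite ler_sqr ?nnegrE ?(ltW e0)// /excess le_max ?lexx ?orbT//.
    by apply/orP; left; move: pe; rewrite /e ltr_norml; lra.
  have n0 : 0 <= (s n)%:R / 2 :> R by rewrite divr_ge0.
  have i1 : (s n).+1%:R^-1 <= 1 :> R by rewrite invf_le1// ler1n.
  have := ler_wpM2l n0 ex; have := mulr_ge0 n0 r0.
  have /andP[_ G1] := objective_bounds (dd_ (s n)); have /andP[G0 _] := objective_bounds d0.
  move: G0 G1 H CP i1; rewrite /C mulrDr; move: ((s n).+1%:R^-1 : R) ((s n)%:R / 2 : R).
  move: (\sum_(j < s n | _) _) (G _) (G _) (g 0) (g 1) (excess _ i ^+ 2) (e ^+ 2).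
  by move=> *; lra.
move=> tT; rewrite leNgt; apply/negP => pa.
have := x_dense tT.
have /subspace_continuousP/(_ t (Theta0_sub tT)) := power_continuous dd.
move=> /cvgr_gt/(_ _ pa); rewrite near_withinE => H /(_ _ H)[i].
by move=> /(_ (Theta0_sub (xT i))); rewrite ltNge feasible_x.
Unshelve. all: end_near. Qed.

(** A power vanishing at one point vanishes everywhere, and then the constant rule
    alpha is feasible with a larger objective. A power 1 at one point is 1
    everywhere, against feasibility, as alpha < 1. Compactness of Theta makes both
    bounds uniform. *)
Lemma limit_power_interior : exists a b, [/\ 0 < a, b < 1 &
  forall t, Theta t -> a <= p delta t <= b].
Proof.
have [t0 Tt0] := Theta0_neq0.
have T0 : Theta !=set0 by exists t0; exact: Theta0_sub.
have ct := power_continuous dd.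
have [t1 + t1P] := EVT_min_rV T0 Theta_compact ct; rewrite inE => Tt1.
have [t2 + t2P] := EVT_max_rV T0 Theta_compact ct; rewrite inE => Tt2.
exists (p delta t1), (p delta t2); split.
- rewrite lt_neqAle power_ge0// andbT eq_sym; apply/eqP => p0.
  have pz t : Theta t -> p delta t = 0.
    by move=> tT; apply: (power_eq0 Tt1).
  have dalpha : decision_rule (fun _ : Y => alpha).
    by apply: decision_rule_cst; rewrite !ltW.
  have := limit_optimal dalpha; rewrite (eq_objective pz).
  have pa t : Theta t -> p (fun=> alpha) t = alpha by exact: power_cst.
  rewrite (eq_objective pa).
  move=> H; have : g alpha <= g 0.
    by apply: H => t /Theta0_sub tT; rewrite power_cst.
  rewrite leNgt (g_increasing A2_differentiable A2_at0 A2_at1 A3)//; exact: ltW.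
- rewrite lt_neqAle power_le1// andbT; apply/eqP => p1.
  have dc := decision_rule_compl dd.
  have pc t : Theta t -> p (fun y => 1 - delta y) t = 1 - p delta t.
    by move=> tT; exact: power_compl.
  have := power_eq0 Tt2 (Theta0_sub Tt0) dc.
  rewrite !pc//; last exact: Theta0_sub.
  rewrite p1 subrr => /(_ erefl) /eqP; rewrite subr_eq0 => /eqP p1'.
  by have := limit_feasible Tt0; rewrite -p1' leNgt alpha_lt1.
- by move=> t tT; rewrite t1P ?t2P ?inE.
Qed.

Lemma weight_within_continuous :
  {within Theta, continuous (fun t => g^`()%classic (p delta t))}.
Proof.
have [a [b [a0 b1 pab]]] := limit_power_interior.
apply/subspace_continuousP => t tT.
have /subspace_continuousP/(_ t tT) ct := power_continuous dd.
by apply: cvg_comp ct _; apply: A2_derivative; have := pab t tT; lra.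
Qed.

(** The difference quotient of the payoff at parameter t, from delta_ n in the
    direction of d. *)
Let Q n d t := (g (p (delta_ n) t + step_size n * (p d t - p (delta_ n) t))
                - g (p (delta_ n) t)) / step_size n.

Let step_size01 n : 0 < (step_size n : R) <= 1.
Proof. by rewrite exprn_gt0//= exprn_ile1// invf_le1// ler1n. Qed.

Let rule_step n d : decision_rule d ->
  decision_rule (fun y => delta_ n y + step_size n * (d y - delta_ n y)).
Proof.
move=> ddd; apply: decision_rule_conv => //.
by have /andP[s0 ->] := step_size01 n; rewrite ltW.
Qed.

Let QE n d t : Theta t -> decision_rule d -> Q n d t =
  (g (p (fun y => delta_ n y + step_size n * (d y - delta_ n y)) t)
   - g (p (delta_ n) t)) / step_size n.
Proof. by move=> tT ddd; rewrite /Q power_conv. Qed.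

Let Q_measurable n d : decision_rule d ->
  measurable_fun (Theta1 : set (borel_rV R d1)) (Q n d).
Proof.
move=> ddd; apply: (eq_measurable_fun (fun t : borel_rV R d1 =>
  (g (p (fun y => delta_ n y + step_size n * (d y - delta_ n y)) t)
   - g (p (delta_ n) t)) / step_size n)).
  by move=> t; rewrite inE => tT; rewrite QE//; exact: Theta1_sub.
by apply: measurable_funM => //; apply: measurable_funB;
  [exact: payoff_measurable (rule_step n ddd)|exact: payoff_measurable (dd_ n)].
Qed.

Let Q_integral n d : decision_rule d ->
  \int[Lambda1]_(t in Theta1) Q n d t <=
  \sum_(i < n) n%:R * excess (delta_ n) i * p d (x i) -
  alpha * \sum_(i < n) n%:R * excess (delta_ n) i + 2 / n.+1%:R.
Proof.
move=> ddd.
have -> : \int[Lambda1]_(t in Theta1) Q n d t =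
    (G (fun y => delta_ n y + step_size n * (d y - delta_ n y)) - G (delta_ n))
    / step_size n.
  have i1 := payoff_integrable (rule_step n ddd); have i2 := payoff_integrable (dd_ n).
  rewrite /objective -RintegralB// -RintegralZr//; last exact: (integrableB mTheta1 i1 i2).
  by apply: eq_Rintegral => t; rewrite inE => /Theta1_sub tT; rewrite QE.
apply: (le_trans (slope_le n ddd)); rewrite lerD2r mulr_sumr -sumrB.
apply: ler_sum => i _; rewrite mulrBr lerD2l lerN2 mulrC.
(* the multiplier is nonzero only where the power of delta_ n exceeds alpha *)
have [pa|pa] := leP (p (delta_ n) (x i)) alpha.
  by rewrite excess_feasible// !(mulr0, mul0r).
apply: ler_wpM2l; last exact: ltW.
by rewrite mulr_ge0// /excess le_max lexx orbT.
Qed.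

(** The powers of delta_ (s n) are eventually in a compact subset of ]0, 1[, where
    g' is bounded by some M. The rule 0 then shows that the multipliers of
    delta_ (s n) have total mass at most (M + 2) / alpha, hence weak limits, and
    dominated convergence gives the limit of the difference quotients. *)
Lemma limit_multipliers : exists (kappa : R) (Lambda0 : probability (borel_rV R d1) R),
  [/\ 0 <= kappa, Lambda0 Theta0 = 1%E & forall d, decision_rule d ->
    \int[Lambda1]_(t in Theta1) (g^`()%classic (p delta t) * (p d t - p delta t)) <=
    kappa * (\int[Lambda0]_(t in Theta0) p d t - alpha)].
Proof.
have [a [b [a0 b1 pab]]] := limit_power_interior.
have [t0 Tt0] := Theta0_neq0.
have := pab t0 (Theta0_sub Tt0) => pab0.
have [M MP] : exists M, forall t, a / 2 <= t <= (1 + b) / 2 -> `|g^`()%classic t| <= M.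
  by apply: g_derivative_bounded => //; lra.
(* Powers within e of [a, b], displaced by a step less than e, remain in
   [a / 2, (1 + b) / 2]. *)
pose e := Num.min (a / 4) ((1 - b) / 4).
have e0 : 0 < e by rewrite lt_min; apply/andP; split; lra.
have step_s : step_size (s n) @[n --> \oo] --> (0 : R).
  apply: (@squeeze_cvgr _ _ _ _ (fun=> 0) (fun n => 1 / (s n).+1%:R)).
  - apply: nearW => n; have /andP[/ltW -> _] := step_size01 (s n).
    rewrite /step_size div1r exprS ler_piMr ?invr_ge0//.
    by rewrite exprn_ile1// invf_le1// ler1n.
  - exact: cvg_cst.
  - exact: inv_s_cvg0.
have [N1 _ N1P] : \forall n \near \oo, forall d, decision_rule d ->
    forall t, Theta t -> `|Q (s n) d t| <= M.
  have /cvgr_lt/(_ e e0) near_step := step_s.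
  apply: filterS2 near_step (p_unif e0) => n se pe d ddd t tT.
  have {}pe := pe t tT; have pt := pab t tT.
  have /andP[st0 _] := step_size01 (s n).
  have h1 : `|p d t - p (delta_ (s n)) t| <= 1.
    have := power01 tT ddd; have := power01 tT (dd_ (s n)).
    by rewrite ler_norml => *; apply/andP; split; lra.
  have sh : `|step_size (s n) * (p d t - p (delta_ (s n)) t)| <= step_size (s n).
    by rewrite normrM gtr0_norm// ler_piMr// ltW.
  apply: (@g_quotient_bounded _ g A2_differentiable (a / 2) ((1 + b) / 2) M _ _ _ _ _ st0 MP).
  - by lra.
  - by lra.
  - move: pe; rewrite lt_min !ltr_norml; lra.
  - move: pe se sh; rewrite !lt_min !ltr_norml ler_norml; lra.
  - by rewrite addrAC subrr add0r.
(* skips the ranks before the bound M on the quotients holds *)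
pose tau n := s (n + N1)%N.
have tauP n d : decision_rule d -> forall t, Theta t -> `|Q (tau n) d t| <= M.
  by apply: N1P; rewrite /= leq_addl.
pose c n i := (tau n)%:R * excess (delta_ (tau n)) i.
have c0 n i : 0 <= c n i by rewrite mulr_ge0// /excess le_max lexx orbT.
have cB n : \sum_(i < tau n) c n i <= (M + 2) / alpha.
  have d0 : decision_rule (fun _ : Y => 0 : R).
    by apply: decision_rule_cst; rewrite lexx ler01.
  have := Q_integral (tau n) d0.
  rewrite big1 => [|i _]; last first.
    by rewrite power_cst ?mulr0//; exact: Theta0_sub.
  have QM : - M <= \int[Lambda1]_(t in Theta1) Q (tau n) (fun=> 0) t.
    rewrite -[leLHS](Rintegral_cst_probability mTheta1 Lambda1_on); apply: le_Rintegral => //.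
    - exact: finite_measure_integrable_cst.
    - apply: (integrable_bounded_probability Lambda1 (M := M) mTheta1); first exact: Q_measurable.
      by move=> t /Theta1_sub tT; exact: tauP.
    - by move=> t /Theta1_sub tT; have := tauP n _ d0 t tT; rewrite ler_norml => /andP[].
  have i1 : 2 / (tau n).+1%:R <= 2 :> R.
    by rewrite ler_piMr// invf_le1// ler1n.
  move=> /(le_trans QM); rewrite sub0r ler_pdivlMr// mulrC => H.
  by move: H i1; rewrite /c; move: (\sum_(i < _) _) ((tau n).+1%:R^-1 : R) => *; lra.
have [r [kappa [Lambda0 [r_ge kappa0 L0 cvgL]]]] :=
  bounded_discrete_measures_cvg Theta0_compact xT c0 cB.
exists kappa, Lambda0; split => // d ddd.
have taur_ge n : (n <= n + N1 <= tau (r n))%N.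
  by rewrite leq_addr/= (leq_trans _ (s_ge _))// leq_add2r.
have tau_cvg (u : nat -> R) (l : R) : u (s n) @[n --> \oo] --> l ->
    u (tau (r n)) @[n --> \oo] --> l.
  move=> ul; apply: (@cvg_comp _ _ _ (fun n => (r n + N1)%N) (fun n => u (s n)) _ \oo).
    move=> U [K _ KU]; exists K => // n /= Kn; apply: KU => /=.
    by rewrite (leq_trans Kn)// (leq_trans (r_ge n))// leq_addr.
  exact: ul.
have lhs : \int[Lambda1]_(t in Theta1) Q (tau (r n)) d t @[n --> \oo] -->
    \int[Lambda1]_(t in Theta1) (g^`()%classic (p delta t) * (p d t - p delta t)).
  apply: (@Rintegral_cvg _ _ _ Lambda1 Theta1 _ _ (fun=> M)) => //.
  - by move=> n; exact: Q_measurable.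
  - have cT := compact_closed_rV Theta_compact.
    have pM := power_measurable Theta1_sub mTheta1.
    apply: measurable_funM; last by apply: measurable_funB; exact: pM.
    apply: (measurable_funS (borel_rV_closed cT) Theta1_sub).
    exact: within_continuous_borel cT weight_within_continuous.
  - exact: finite_measure_integrable_cst.
  - apply: aeW => t /Theta1_sub tT.
    have pt : p (delta_ (tau (r n))) t @[n --> \oo] --> p delta t.
      exact: (tau_cvg (fun n => p (delta_ n) t) _ (limit_power_cvg tT)).
    apply: (g_strict_derivative A2_differentiable A2_derivative) => //.
    + by have := pab t tT; lra.
    + by apply: cvgB => //; exact: cvg_cst.
    + exact: (tau_cvg step_size _ step_s).
    + by move=> n; case/andP: (step_size01 (tau (r n))).
  - by move=> n t /Theta1_sub; exact: tauP.
have one_continuous : {within Theta0, continuous (fun _ : 'rV[R]_d1 => 1 : R)}.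
  exact: cst_continuous.
have pd_continuous : {within Theta0, continuous (p d)}.
  apply: (continuous_subspaceW Theta0_sub).
  exact: power_continuous.
have rhs : \sum_(i < tau (r n)) c (r n) i * p d (x i) -
    alpha * \sum_(i < tau (r n)) c (r n) i * 1 + 2 / (tau (r n)).+1%:R @[n --> \oo] -->
    kappa * \int[Lambda0]_(t in Theta0) p d t -
    alpha * (kappa * \int[Lambda0]_(t in Theta0) 1) + 0.
  apply: cvgD; last exact: (tau_cvg (fun n => 2 / n.+1%:R) _ (inv_s_cvg0 2)).
  apply: cvgB; first exact: cvgL pd_continuous.
  by apply: cvgMl_tmp; exact: cvgL one_continuous.
have mT0 := borel_rV_closed (compact_closed_rV Theta0_compact).
have : \int[Lambda1]_(t in Theta1) (g^`()%classic (p delta t) * (p d t - p delta t)) <=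
    kappa * \int[Lambda0]_(t in Theta0) p d t -
    alpha * (kappa * \int[Lambda0]_(t in Theta0) 1) + 0.
  apply: (ler_cvg_to lhs rhs); apply: nearW => n.
  under [X in alpha * X]eq_bigr do rewrite mulr1.
  exact: Q_integral.
by rewrite (Rintegral_cst_probability mT0 L0) mulr1 addr0 mulrBr (mulrC kappa alpha).
Qed.

End penalization.

Lemma constrained_optimum : exists (delta : Y -> R) (kappa : R)
    (Lambda0 : probability (borel_rV R d1) R),
  [/\ decision_rule delta, forall t, Theta0 t -> p delta t <= alpha,
    forall d, decision_rule d -> (forall t, Theta0 t -> p d t <= alpha) ->
      G d <= G delta,
    exists a b, [/\ 0 < a, b < 1 & forall t, Theta t -> a <= p delta t <= b] &
    [/\ 0 <= kappa, Lambda0 Theta0 = 1%E,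
      {within Theta, continuous (fun t => g^`()%classic (p delta t))} &
      forall d, decision_rule d ->
      \int[Lambda1]_(t in Theta1) (g^`()%classic (p delta t) * (p d t - p delta t)) <=
      kappa * (\int[Lambda0]_(t in Theta0) p d t - alpha)]].
Proof.
have [t0 Tt0] := Theta0_neq0.
have Theta_neq0 : Theta !=set0 by exists t0; exact: Theta0_sub.
have [x [xT x_dense]] := dense_sequence Theta0_compact Theta0_neq0.
have [delta_ [dd_ penalty_ge slope_le]] :=
  penalized_sequence xT.
have [s [delta [s_ge dd p_unif]]] := power_sequentially_compact
  Theta_neq0 dd_.
have fe := limit_feasible xT x_dense dd_ penalty_ge s_ge dd p_unif.
have op := limit_optimal xT dd_ penalty_ge s_ge dd p_unif.
have int := limit_power_interior xT x_dense dd_ penalty_ge s_ge dd p_unif.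
have wc := weight_within_continuous xT x_dense dd_
  penalty_ge s_ge dd p_unif.
have [kappa [Lambda0 [k0 L0 kkt]]] := limit_multipliers xT x_dense dd_
  penalty_ge slope_le s_ge dd p_unif.
by exists delta, kappa, Lambda0.
Qed.

End experiment.

(** * Mixtures of densities *)

Section tonelli.
Context {R : realType} {d1 : nat} {dY : measure_display}
  {Y : measurableType dY}.
Variables (mu : {sigma_finite_measure set Y -> \bar R}) (f : 'rV[R]_d1 -> Y -> R).
Variables Theta A : set 'rV[R]_d1.
Hypothesis f_density : forall theta, Theta theta -> is_density mu (f theta).
Hypothesis f_measurable : measurable_fun
  (Theta `*` setT : set (borel_rV R d1 * Y)) (fun p => f p.1 p.2).
Hypothesis mTheta : measurable (Theta : set (borel_rV R d1)).
Hypothesis A_sub : A `<=` Theta.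
Hypothesis mA : measurable (A : set (borel_rV R d1)).
Variable Lambda : probability (borel_rV R d1) R.
Variables (w : 'rV[R]_d1 -> R) (M : R).
Hypothesis mw : measurable_fun (A : set (borel_rV R d1)) w.
Hypothesis w0 : forall t, A t -> 0 <= w t.
Hypothesis wM : forall t, A t -> w t <= M.

Local Notation p := (power mu f).

(* Extended by 0 outside A, since Tonelli is applied on the whole product. *)
Let k : borel_rV R d1 * Y -> R :=
  (fun z => w z.1 * f z.1 z.2) \_ (A `*` setT).

Let mAT : measurable (A `*` setT : set (borel_rV R d1 * Y)).
Proof. exact: measurableX. Qed.

Let k_measurable : measurable_fun setT k.
Proof.
apply/(measurable_restrictT _ mAT); apply: measurable_funM.
  apply: (measurable_comp mA _ mw); first by move=> _ [z [Az _] <-].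
  exact: measurable_funS measurable_fst.
apply: measurable_funS f_measurable; first exact: measurableX.
by move=> z [/A_sub].
Qed.

Let k_ge0 z : 0 <= k z.
Proof.
rewrite /k patchE; case: ifPn => //; rewrite inE => -[Az _].
by rewrite mulr_ge0 ?w0// (density_ge0 f_density)//; exact: A_sub.
Qed.

Let kE t y : A t -> k (t, y) = w t * f t y.
Proof. by move=> At; rewrite /k patchE mem_set. Qed.

Let kN t y : ~ A t -> k (t, y) = 0.
Proof. by move=> At; rewrite /k patchE memNset// => -[]. Qed.

(** Both mixtures of the theorem have this form: H with weight g'(p(t; delta)) on
    Theta1, and kappa times the other one with constant weight kappa on Theta0. *)
Definition mixed_density (y : Y) : \bar R := (\int[Lambda]_(t in A) (w t * f t y)%:E)%E.

Let mixE y : mixed_density y = (\int[Lambda]_t (k (t, y))%:E)%E.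
Proof.
rewrite /mixed_density integral_mkcond; apply: eq_integral => t _.
by rewrite /k !patchE; case: (boolP (t \in A)); rewrite ?inE => At;
  [rewrite mem_set|rewrite memNset// => -[/mem_set]; rewrite (negbTE At)].
Qed.

Lemma mixed_density_ge0 y : (0 <= mixed_density y)%E.
Proof. by rewrite mixE; apply: integral_ge0 => t _; rewrite lee_fin. Qed.

Lemma measurable_mixed_density : measurable_fun setT mixed_density.
Proof.
apply: (eq_measurable_fun (fun y => \int[Lambda]_t (k (t, y))%:E)%E).
  by move=> y _; rewrite mixE.
by apply: (measurable_fun_fubini_tonelli_G (EFin \o k)) => [|z];
  [exact/measurable_EFinP|rewrite lee_fin].
Qed.

(** The average of powers is linear in the rule, with the mixture of the densities
    as its kernel. *)
Lemma tonelli_power delta : decision_rule delta ->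
  (\int[Lambda]_(t in A) (w t * p delta t)%:E =
   \int[mu]_y ((delta y)%:E * mixed_density y))%E.
Proof.
move=> dd; have [md d01] := dd.
pose K (z : borel_rV R d1 * Y) := (k z * delta z.2)%:E.
have K0 z : (0 <= K z)%E.
  by rewrite lee_fin mulr_ge0//; case/andP: (d01 z.2).
have mK : measurable_fun setT K.
  apply/measurable_EFinP; apply: measurable_funM => //.
  exact: measurableT_comp.
have := fubini_tonelli (m1 := Lambda) (m2 := mu) K mK K0.
have -> : (\int[Lambda]_x \int[mu]_y K (x, y) = \int[Lambda]_(t in A) (w t * p delta t)%:E)%E.
  rewrite [RHS]integral_mkcond; apply: eq_integral => t _; rewrite patchE.
  case: ifPn => [|tA]; last first.
    apply: integral0_eq => y _; rewrite /K kN ?mul0r// => At.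
    by rewrite mem_set in tA.
  rewrite inE => At.
  have it := power_integrable f_density (A_sub At) dd.
  under eq_integral => y _ do rewrite /K kE// -mulrA (mulrC (f t y)) EFinM.
  rewrite integralZl// [RHS]EFinM; congr (_ * _)%E.
  by rewrite /power /Rintegral fineK//; exact: integrable_fin_num.
move=> ->; apply: eq_integral => y _.
rewrite mixE -ge0_integralZl//.
- by apply: eq_integral => t _; rewrite /K -EFinM mulrC.
- by apply/measurable_EFinP; exact: measurableT_comp.
- by move=> t _; rewrite lee_fin.
- by rewrite lee_fin; case/andP: (d01 y).
Qed.

Lemma weighted_power_integrable delta : decision_rule delta ->
  measurable_fun (A : set (borel_rV R d1)) (p delta) ->
  Lambda.-integrable A (EFin \o (fun t => w t * p delta t)).
Proof.
move=> dd mp; apply: (integrable_bounded_probability Lambda (M := M) mA).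
  exact: measurable_funM.
move=> t At; have p0 := power_ge0 f_density (A_sub At) dd.
have p1 := power_le1 f_density (A_sub At) dd.
rewrite ger0_norm ?mulr_ge0 ?w0//.
by apply: le_trans (wM At); rewrite ler_piMr// w0.
Qed.

Lemma mixed_density_integrable :
  measurable_fun (A : set (borel_rV R d1)) (p (fun=> 1)) ->
  mu.-integrable setT mixed_density.
Proof.
move=> mp; apply/integrableP; split; first exact: measurable_mixed_density.
have dr1 : decision_rule (fun _ : Y => 1 : R).
  by apply: decision_rule_cst; rewrite ler01 lexx.
have := integrable_lty mA (weighted_power_integrable dr1 mp).
under [X in (_ -> X < _)%E]eq_integral do rewrite gee0_abs ?mixed_density_ge0//.
rewrite [X in (X < _)%E -> _](tonelli_power dr1).
by rewrite (eq_integral mixed_density)// => y _; rewrite mul1e.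
Qed.

(** The mixture may be infinite at exceptional points, but is finite almost
    everywhere. *)
Lemma Rtonelli_power delta : decision_rule delta ->
  measurable_fun (A : set (borel_rV R d1)) (p (fun=> 1)) ->
  \int[Lambda]_(t in A) (w t * p delta t) =
  \int[mu]_y (delta y * fine (mixed_density y)).
Proof.
move=> dd mp; have [md d01] := dd.
have imix := mixed_density_integrable mp.
rewrite /Rintegral (tonelli_power dd); congr fine.
have mm := measurable_mixed_density.
apply: ae_eq_integral => //.
- by apply: emeasurable_funM => //; exact/measurable_EFinP.
- apply/measurable_EFinP; apply: measurable_funM => //.
  exact: measurableT_comp.
- apply: filterS (integrable_ae measurableT imix) => y /(_ I) fy _.
  by rewrite EFinM fineK.
Qed.

Lemma mixed_density_cst (kappa : R) y : 0 <= kappa ->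
  (\int[Lambda]_(t in A) (kappa * f t y)%:E = kappa%:E * mixture f A Lambda y)%E.
Proof.
move=> kappa0.
have f0 t : A t -> (0 <= (f t y)%:E)%E.
  by move=> /A_sub tT; rewrite lee_fin (density_ge0 f_density).
have mfy : measurable_fun (A : set (borel_rV R d1)) (fun t => (f t y)%:E).
  apply/measurable_EFinP.
  have my : measurable_fun (A : set (borel_rV R d1)) (fun t : borel_rV R d1 => (t, y)).
    exact: measurable_funS (pair2_measurable y).
  apply: (measurable_comp (measurableX mTheta measurableT) _ f_measurable my).
  by move=> _ [t /A_sub tT <-].
have <- := @ge0_integralZl_EFin _ _ _ Lambda A mA _ f0 mfy kappa kappa0.
by apply: eq_integral => t _; rewrite EFinM.
Qed.

End tonelli.

(** * Threshold rules *)

Section threshold.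
Context {R : realType} {dY : measure_display} {Y : measurableType dY}.
Variables (mu : {measure set Y -> \bar R}) (H K : Y -> \bar R).
Hypothesis iH : mu.-integrable setT H.
Hypothesis iK : mu.-integrable setT K.

Definition threshold_rule (delta : Y -> R) (y : Y) : R :=
  if (K y < H y)%E then 1 else if (H y < K y)%E then 0 else delta y.

Lemma threshold_rule_decision delta :
  decision_rule delta -> decision_rule (threshold_rule delta).
Proof.
have mH := measurable_int mu iH; have mK := measurable_int mu iK.
move=> [md d01]; split; last first.
  by move=> y; rewrite /threshold_rule; case: ifP => _; [|case: ifP => _];
    rewrite ?lexx ?ler01.
apply: measurable_fun_ifT => //; first exact: measurable_fun_lte.
by apply: measurable_fun_ifT => //; exact: measurable_fun_lte.
Qed.

(** The product of threshold_rule delta - delta with H - K is nonnegative at each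
    point where both are finite, and its integral is nonpositive since delta is
    a maximiser; so it vanishes almost everywhere. Where H and K differ this gives
    equality of the two rules, and where they agree the rules coincide by
    definition. *)
Lemma threshold_rule_ae delta : decision_rule delta ->
  (forall delta', decision_rule delta' ->
    \int[mu]_y (delta' y * fine (H y)) - \int[mu]_y (delta' y * fine (K y)) <=
    \int[mu]_y (delta y * fine (H y)) - \int[mu]_y (delta y * fine (K y))) ->
  {ae mu, forall y, threshold_rule delta y = delta y}.
Proof.
move=> dd opt; have dt := threshold_rule_decision dd.
have ifine (F : Y -> \bar R) d : mu.-integrable setT F -> decision_rule d ->
    mu.-integrable setT (EFin \o (fun y => d y * fine (F y))).
  move=> iF [md d01]; have mF := measurable_int mu iF.
  apply: le_integrable iF => //.
    apply/measurable_EFinP; apply: measurable_funM => //.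
    exact: measurableT_comp.
  move=> y _; rewrite /= normrM EFinM -[leRHS]mul1e lee_pmul ?lee_fin//.
    by rewrite ler_norml; have := d01 y; lra.
  by case: (F y) => [r||] //=; rewrite leey.
pose D y := (threshold_rule delta y - delta y) * (fine (H y) - fine (K y)).
have i1 := integrableB measurableT (ifine _ _ iH dt) (ifine _ _ iK dt).
have i2 := integrableB measurableT (ifine _ _ iH dd) (ifine _ _ iK dd).
have iD : mu.-integrable setT (EFin \o D).
  have := integrableB measurableT i1 i2; apply: eq_integrable => // y _.
  by rewrite /= /D; congr EFin; ring.
have fin_ae : {ae mu, forall y, H y \is a fin_num /\ K y \is a fin_num}.
  by apply: filterS2 (integrable_ae measurableT iH) (integrable_ae measurableT iK)
    => y /(_ I) ? /(_ I) ?.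
have D_ae : {ae mu, forall y, `|D y| = D y}.
  apply: filterS fin_ae => y [fH fK]; apply: ger0_norm.
  rewrite /D /threshold_rule -(fineK fH) -(fineK fK) !lte_fin.
  have [_ /(_ y) d01] := dd.
  have [HK|HK|->] := ltgtP (fine (H y)) (fine (K y)) => /=.
  - by nra.
  - by nra.
  - by rewrite subrr mul0r.
have D_int : \int[mu]_y D y <= 0.
  rewrite (_ : \int[mu]_y D y =
    (\int[mu]_y (threshold_rule delta y * fine (H y)) -
     \int[mu]_y (threshold_rule delta y * fine (K y))) -
    (\int[mu]_y (delta y * fine (H y)) - \int[mu]_y (delta y * fine (K y)))).
    by rewrite subr_le0; exact: opt.
  rewrite -!RintegralB//; try exact: ifine.
  by apply: eq_Rintegral => y _; rewrite /D; ring.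
have D0 : (\int[mu]_y `|(EFin \o D) y| = 0)%E.
  apply/eqP; rewrite eq_le integral_ge0// andbT.
  rewrite (@ae_eq_integral _ _ _ mu setT (EFin \o D))//.
  - by rewrite -[leLHS]fineK ?lee_fin//; exact: integrable_fin_num.
  - by apply: measurableT_comp => //; exact: (measurable_int mu iD).
  - exact: (measurable_int mu iD).
  - by apply: filterS D_ae => y DE _; rewrite /= DE.
have := (ae_eq_integral_abs mu measurableT (measurable_int mu iD)).1 D0.
apply: filterS2 fin_ae => y [fH fK] /(_ I) [].
rewrite /D /threshold_rule -(fineK fH) -(fineK fK) !lte_fin.
have [HK|HK|//] := ltgtP (fine (H y)) (fine (K y)) => /= /eqP;
  rewrite mulf_eq0 !subr_eq0 => /orP[/eqP //|/eqP HK'];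
  by rewrite HK' ltxx in HK.
Qed.

End threshold.

(** * The optimal rule *)

Lemma ae_eq_power (R : realType) (d1 : nat) (dY : measure_display)
    (Y : measurableType dY) (mu : {measure set Y -> \bar R})
    (f : 'rV[R]_d1 -> Y -> R) (Theta : set 'rV[R]_d1) (delta delta' : Y -> R) t :
  (forall theta, Theta theta -> is_density mu (f theta)) -> Theta t ->
  decision_rule delta -> decision_rule delta' ->
  {ae mu, forall y, delta y = delta' y} ->
  power mu f delta t = power mu f delta' t.
Proof.
move=> fd tT dd dd' ae; rewrite /power /Rintegral; congr fine.
apply: ae_eq_integral => //.
- exact: (measurable_int mu (power_integrable fd tT dd)).
- exact: (measurable_int mu (power_integrable fd tT dd')).
- by apply: filterS ae => y /= -> _.
Qed.

(** The set of powers is nonempty and bounded, without which a bound on the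
    supremum would say nothing about its elements. *)
Lemma size_on_leP (R : realType) (d1 : nat) (dY : measure_display)
    (Y : measurableType dY) (mu : {measure set Y -> \bar R})
    (f : 'rV[R]_d1 -> Y -> R) (Theta0 : set 'rV[R]_d1) (delta : Y -> R) (alpha : R) :
  (forall theta, Theta0 theta -> is_density mu (f theta)) -> Theta0 !=set0 ->
  decision_rule delta ->
  size_on mu f Theta0 delta <= alpha <->
  forall t, Theta0 t -> power mu f delta t <= alpha.
Proof.
move=> fd [t0 Tt0] dd; split=> [sa t tT|H].
  apply: le_trans sa; apply: ub_le_sup; last by exists t.
  by exists 1 => _ [u uT <-]; exact: (power_le1 fd).
apply: ge_sup => [|_ [t tT <-]]; last exact: H.
by exists (power mu f delta t0), t0.
Qed.

Theorem theorem10 (R : realType) (d1 d2 : nat) (d1_gt0 : (0 < d1)%N)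
  (d2_gt0 : (0 < d2)%N)
  (Theta Theta0 Theta1 : set 'rV[R]_d1)
  (Theta_compact : compact Theta)
  (Theta0_sub : Theta0 `<=` Theta)
  (Theta1_def : Theta1 = Theta `\` Theta0)
  (Theta0_neq0 : Theta0 !=set0)
  (Theta1_neq0 : Theta1 !=set0)
  (YY : set 'rV[R]_d2) (YY_neq0 : YY !=set0)
  (mu : {sigma_finite_measure set (borel_subset YY_neq0) -> \bar R})
  (f : 'rV[R]_d1 -> borel_subset YY_neq0 -> R)
  (f_density : forall theta, Theta theta -> is_density mu (f theta))
  (f_measurable : measurable_fun
     (Theta `*` setT : set (borel_rV R d1 * borel_subset YY_neq0))
     (fun p => f p.1 p.2))
  (alpha : R) (alpha_gt0 : 0 < alpha) (alpha_lt1 : alpha < 1)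
  (g : R -> R) (g_measurable : measurable_fun (`[0, 1] : set R) g)
  (Lambda1 : probability (borel_rV R d1) R)
  (Lambda1_on : Lambda1 Theta1 = 1%E)
  (A1_continuity : forall (theta_ : nat -> 'rV[R]_d1) (theta : 'rV[R]_d1),
     (forall n, Theta (theta_ n)) -> Theta theta ->
     theta_ n @[n --> \oo] --> theta ->
     (\int[mu]_y (`|f (theta_ n) y - f theta y|)%:E)%E @[n --> \oo] --> 0%E)
  (A1_equivalence : forall theta theta', Theta theta -> Theta theta' ->
     law mu f theta `<< law mu f theta' /\ law mu f theta' `<< law mu f theta)
  (A2_differentiable : forall t : R, 0 < t < 1 -> derivable g t 1)
  (A2_derivative : forall t : R, 0 < t < 1 -> {for t, continuous g^`()%classic})
  (A2_at0 : g t @[t --> 0^'+] --> g 0)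
  (A2_at1 : g t @[t --> 1^'-] --> g 1)
  (A3 : forall t : R, 0 < t < 1 -> 0 < g^`()%classic t)
  (Theta0_closed : closed Theta0) :
  exists delta : borel_subset YY_neq0 -> R,
    [/\ optimal mu f Theta0 Theta1 alpha Lambda1 g delta,
        size_on mu f Theta0 delta = alpha
      & exists (kappa : R) (gamma : borel_subset YY_neq0 -> R)
               (Lambda0 : probability (borel_rV R d1) R),
          [/\ 0 <= kappa, decision_rule gamma, Lambda0 Theta0 = 1%E
            & forall y,
                let H := weighted_mixture mu f Theta1 Lambda1 g delta y in
                let F := (kappa%:E * mixture f Theta0 Lambda0 y)%E in
                [/\ (F < H)%E -> delta y = 1,
                    H = F -> delta y = gamma y
                  & (H < F)%E -> delta y = 0]]].
Proof.
have cT := compact_closed_rV Theta_compact.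
have cT0 : compact Theta0 by exact: subclosed_compact Theta_compact Theta0_sub.
have mT : measurable (Theta : set (borel_rV R d1)) by exact: borel_rV_closed.
have mT0 : measurable (Theta0 : set (borel_rV R d1)) by exact: borel_rV_closed.
have T1_sub : Theta1 `<=` Theta by rewrite Theta1_def; exact: subDsetl.
have mT1 : measurable (Theta1 : set (borel_rV R d1)).
  by rewrite Theta1_def; exact: measurableD.
have [delta0 [kappa [Lambda0 [dd0 feas0 opt0 [a [b [a0 b1 pab]]] [k0 L0 wc kkt]]]]] :=
  constrained_optimum Theta_compact f_density A1_continuity A1_equivalence
  Theta0_sub cT0 Theta0_neq0 T1_sub mT1 Lambda1_on alpha_gt0 alpha_lt1
  g_measurable A2_differentiable A2_derivative A2_at0 A2_at1 A3.
pose p := power mu f.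
pose w t := g^`()%classic (p delta0 t).
have [t0 Tt0] := Theta0_neq0.
have [M MP] := g_derivative_bounded A2_derivative a0 b1.
have w0 t : Theta t -> 0 < w t.
  by move=> tT; apply: A3; have := pab t tT; rewrite -/(p delta0 t); lra.
have wM t : Theta t -> w t <= M.
  by move=> tT; apply: le_trans (MP _ (pab t tT)); exact: ler_norm.
have mw : measurable_fun (Theta1 : set (borel_rV R d1)) w.
  apply: (measurable_funS mT T1_sub).
  exact: within_continuous_borel cT wc.
have mp A d : A `<=` Theta -> measurable (A : set (borel_rV R d1)) ->
    decision_rule d -> measurable_fun (A : set (borel_rV R d1)) (p d).
  move=> AT mA dd; exact: (power_measurable Theta_compact f_density A1_continuity AT mA dd).
have dr1 : decision_rule (fun _ : borel_subset YY_neq0 => 1 : R).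
  by apply: decision_rule_cst; rewrite ler01 lexx.
pose H := mixed_density f Theta1 Lambda1 w.
pose K := mixed_density f Theta0 Lambda0 (fun=> kappa).
have iH : mu.-integrable setT H.
  apply: (mixed_density_integrable f_density f_measurable mT T1_sub mT1 _ (M := M)) => //.
  - by move=> t /T1_sub tT; exact/ltW/w0.
  - by move=> t /T1_sub; exact: wM.
  - exact: mp.
have iK : mu.-integrable setT K.
  apply: (mixed_density_integrable f_density f_measurable mT Theta0_sub mT0 _ (M := kappa)) => //.
  exact: mp.
have ip1 d : decision_rule d -> Lambda1.-integrable Theta1 (EFin \o (fun t => w t * p d t)).
  move=> ddd; apply: (weighted_power_integrable f_density T1_sub mT1 _ mw _ _ ddd (M := M)).
  - by move=> t /T1_sub tT; exact/ltW/w0.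
  - by move=> t /T1_sub; exact: wM.
  - exact: mp.
have ip0 d : decision_rule d -> Lambda0.-integrable Theta0 (EFin \o p d).
  move=> ddd; apply: (integrable_bounded_probability Lambda0 (M := 1) mT0); first exact: mp.
  move=> t /Theta0_sub tT; rewrite ger0_norm ?(power_ge0 f_density)//.
  exact: (power_le1 f_density).
have HE d : decision_rule d ->
    \int[mu]_y (d y * fine (H y)) = \int[Lambda1]_(t in Theta1) (w t * p d t).
  move=> ddd; apply/esym.
  apply: (Rtonelli_power f_density f_measurable mT T1_sub mT1 _ mw _ _ ddd (M := M)).
  - by move=> t /T1_sub tT; exact/ltW/w0.
  - by move=> t /T1_sub; exact: wM.
  - exact: mp.
have KE d : decision_rule d ->
    \int[mu]_y (d y * fine (K y)) = kappa * \int[Lambda0]_(t in Theta0) p d t.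
  move=> ddd; rewrite -RintegralZl//; last exact: ip0.
  apply/esym; apply: (Rtonelli_power f_density f_measurable mT Theta0_sub mT0 _ _ _ _ ddd (M := kappa)) => //.
  exact: mp.
have kkt' d : decision_rule d ->
    \int[Lambda1]_(t in Theta1) (w t * p d t) -
    \int[Lambda1]_(t in Theta1) (w t * p delta0 t) <=
    kappa * (\int[Lambda0]_(t in Theta0) p d t - alpha).
  move=> dd; apply: le_trans (kkt d dd); rewrite -RintegralB//; try exact: ip1.
  by rewrite le_eqVlt; apply/orP; left; apply/eqP; apply: eq_Rintegral => t _; rewrite -mulrBr.
have p0_le : \int[Lambda0]_(t in Theta0) p delta0 t <= alpha.
  rewrite -(Rintegral_cst_probability mT0 L0 alpha); apply: le_Rintegral => //.
  - exact: ip0.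
  - exact: finite_measure_integrable_cst.
(* complementary slackness: the inequality at d = delta0, and feasibility *)
have := kkt' _ dd0; rewrite subrr => kkt0.
have slack : kappa * \int[Lambda0]_(t in Theta0) p delta0 t = kappa * alpha.
  by apply/eqP; rewrite eq_le ler_wpM2l//= -subr_ge0 -mulrBr.
pose delta := threshold_rule H K delta0.
have dd : decision_rule delta by exact: threshold_rule_decision iH iK _ dd0.
have ae : {ae mu, forall y, delta y = delta0 y}.
  apply: (threshold_rule_ae iH iK dd0) => d ddd.
  rewrite !HE// !KE// slack.
  by have := kkt' d ddd; lra.
have pE t : Theta t -> p delta t = p delta0 t.
  by move=> tT; exact: ae_eq_power f_density tT dd dd0 ae.
have GE : objective mu f Theta1 Lambda1 g delta = objective mu f Theta1 Lambda1 g delta0.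
  by apply: eq_Rintegral => t; rewrite inE => /T1_sub tT; congr g; exact: pE.
have f_density0 t : Theta0 t -> is_density mu (f t) by move=> /Theta0_sub; exact: f_density.
have feas : size_on mu f Theta0 delta <= alpha.
  apply/(size_on_leP alpha f_density0 Theta0_neq0 dd) => t tT.
  by rewrite -/(p delta t) pE; [exact: feas0|exact: Theta0_sub].
exists delta; split.
- split; first by split.
  move=> d [ddd sd]; rewrite GE; apply: opt0 => //.
  exact/(size_on_leP alpha f_density0 Theta0_neq0 ddd).
- apply/eqP; rewrite eq_le feas/= leNgt; apply/negP => sa.
  (* a size less than alpha leaves slack, so that kappa = 0 *)
  have p0_lt : \int[Lambda0]_(t in Theta0) p delta0 t < alpha.
    apply: le_lt_trans sa.
    rewrite -(Rintegral_cst_probability mT0 L0 (size_on _ _ _ _)); apply: le_Rintegral => //.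
    - exact: ip0.
    - exact: finite_measure_integrable_cst.
    - move=> t tT; rewrite -pE; last exact: Theta0_sub.
      exact: ((size_on_leP (size_on mu f Theta0 delta) f_density0 Theta0_neq0 dd).1 (lexx _) t tT).
  have kappa0 : kappa = 0.
    move: slack => /eqP; rewrite -subr_eq0 -mulrBr mulf_eq0 subr_eq0.
    by case/orP => [/eqP//|/eqP E]; rewrite E ltxx in p0_lt.
  (* the rule 1 then has a positive first-order gain, as g' and 1 - p are bounded
     below on Theta1 *)
  have T_neq0 : Theta !=set0 by exists t0; exact: Theta0_sub.
  have [t1 + t1P] := EVT_min_rV T_neq0 Theta_compact wc; rewrite inE => Tt1.
  have gap : 0 < w t1 * (1 - b) by rewrite mulr_gt0 ?w0// subr_gt0.
  have := kkt _ dr1; rewrite kappa0 mul0r leNgt => /negP; apply.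
  apply: (lt_le_trans gap); rewrite -(Rintegral_cst_probability mT1 Lambda1_on (w t1 * (1 - b))).
  apply: le_Rintegral => //.
  - exact: finite_measure_integrable_cst.
  - apply: eq_integrable (integrableB mT1 (ip1 _ dr1) (ip1 _ dd0)) => // t _.
    by rewrite /= mulrBr EFinB.
  - move=> t /T1_sub tT; rewrite (power_cst f_density)//.
    have wt : w t1 <= w t by apply: t1P; rewrite inE.
    apply: ler_pM => //; [exact/ltW/w0|by rewrite subr_ge0 ltW|].
    by have := pab t tT; lra.
- (* being a threshold rule, delta serves as its own randomisation on ties *)
  exists kappa, delta, Lambda0; split => // y.
  have HyE : weighted_mixture mu f Theta1 Lambda1 g delta y = H y.
    apply: eq_integral => t; rewrite inE => /T1_sub tT.
    by rewrite /w -/(p delta t) pE.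
  have KyE : (kappa%:E * mixture f Theta0 Lambda0 y)%E = K y.
    exact/esym/(mixed_density_cst f_density f_measurable mT Theta0_sub mT0 Lambda0 y k0).
  rewrite /= HyE KyE /delta /threshold_rule; split => [-> //|//|HK].
  by rewrite HK ltNge (ltW HK).
Qed.
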